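(* (Srivastava-Agarwal type bilinear generating function for $\phi_n^{(\mathbf a,\mathbf b)}(x,y|q)$.) Let $|q|<1$. The following bilinear generating function holds true: $$\sum_{n=0}^\infty\phi_n^{(\mathbf a,\mathbf b)}(x,y|q)\,\phi_n^{(\alpha)}(\mu|q)\,\frac{t^n}{(q;q)_n}=\frac{(\alpha\mu yt;q)_\infty}{(\mu yt,yt;q)_\infty}\sum_{j=0}^\infty\frac{(a_1,a_2,\dots,a_{r+1};q)_j}{(q,b_1,b_2,\dots,b_r;q)_j}\,(xt)^j\;{}_3\Phi_1\!\left[\begin{matrix}q^{-j},\,\alpha,\,yt\\ \alpha\mu yt\end{matrix};q;\mu q^j\right]\qquad(\max\{|yt|,|\mu yt|\}<1).$$
   Context: Notation: $(a;q)_0=1$, $(a;q)_n=\prod_{k=0}^{n-1}(1-aq^k)$, $(a;q)_\infty=\prod_{k=0}^\infty(1-aq^k)$, $(c_1,\dots,c_m;q)_n=(c_1;q)_n\cdots(c_m;q)_n$ (also for $n=\infty$), and $\left[{n\atop k}\right]_q=\frac{(q;q)_n}{(q;q)_k(q;q)_{n-k}}$ is the $q$-binomial coefficient. Basic hypergeometric series: ${}_{u}\Phi_{v}\!\left[\begin{matrix}\alpha_1,\dots,\alpha_{u}\\ \beta_1,\dots,\beta_{v}\end{matrix};q;z\right]=\sum_{k\ge0}\left[(-1)^kq^{\binom k2}\right]^{1+v-u}\frac{(\alpha_1,\dots,\alpha_{u};q)_k}{(\beta_1,\dots,\beta_{v};q)_k}\frac{z^k}{(q;q)_k}$, where $q\neq0$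 when $u>v+1$. With parameters $\mathbf a=(a_1,\dots,a_{r+1})$ and $\mathbf b=(b_1,\dots,b_r)$, the generalized Al-Salam-Carlitz $q$-polynomials $\phi_n^{(\mathbf a,\mathbf b)}$ and the Hahn (Al-Salam-Carlitz) polynomials $\phi_n^{(\alpha)}$ are $$\phi_n^{(\mathbf a,\mathbf b)}(x,y|q)=\sum_{k=0}^n\left[{n\atop k}\right]_q\frac{(a_1,\dots,a_{r+1};q)_k}{(b_1,\dots,b_r;q)_k}\,x^ky^{n-k},\qquad \phi_n^{(\alpha)}(\mu|q)=\sum_{k=0}^n\left[{n\atop k}\right]_q(\alpha;q)_k\,\mu^k.$$
   Formalization: The printed condition does not ensure convergence (y=a_1=α=μ=0, r=0, xt=1 diverges), so: both sides converge or diverge together, with equal sums; convergence is asserted if max{|xt|,|μxt|}<1. Assumed: q≠0, no b_i or αμyt equals q^{-k}. *)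

(* Defs.v *)
(* Stdlib reals with Coquelicot's complex numbers. *)
From Stdlib Require Export Reals List ZArith.
From Coquelicot Require Export Coquelicot.

Open Scope R_scope.
Open Scope C_scope.

(* Limits and sums of complex sequences are taken componentwise, so these
   total operators have a meaningful value exactly on convergent arguments. *)
Definition CLim_seq (u : nat -> C) : C :=
  (real (Lim_seq (fun n => Re (u n))), real (Lim_seq (fun n => Im (u n)))).

Definition CSeries (u : nat -> C) : C :=
  (Series (fun n => Re (u n)), Series (fun n => Im (u n))).

Definition Cpowz (z : C) (n : Z) : C :=
  match n with
  | Z0 => 1
  | Zpos p => z ^ Pos.to_nat p
  | Zneg p => / z ^ Pos.to_nat p
  end.

Fixpoint qpoch (a q : C) (n : nat) : C :=
  match n with
  | O => 1
  | S k => qpoch a q k * (1 - a * q ^ k)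
  end.

Definition qpoch_inf (a q : C) : C := CLim_seq (qpoch a q).

(* (c_1, ..., c_m; q)_n and (c_1, ..., c_m; q)_oo. *)
Definition qpochs (cs : list C) (q : C) (n : nat) : C :=
  fold_right (fun c p => qpoch c q n * p) 1 cs.

Definition qpochs_inf (cs : list C) (q : C) : C :=
  fold_right (fun c p => qpoch_inf c q * p) 1 cs.

Definition qbinom (q : C) (n k : nat) : C :=
  qpoch q q n / (qpoch q q k * qpoch q q (n - k)).

(* The basic hypergeometric series with u = length al and v = length be;
   the exponent 1 + v - u is an integer, possibly negative. *)
Definition qhyper_term (al be : list C) (q z : C) (k : nat) : C :=
  Cpowz ((- (1)) ^ k * q ^ (k * (k - 1) / 2))
        (1 + Z.of_nat (length be) - Z.of_nat (length al))
  * (qpochs al q k / qpochs be q k) * (z ^ k / qpoch q q k).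

Definition qhyper (al be : list C) (q z : C) : C :=
  CSeries (qhyper_term al be q z).

(* phi_n^(a,b)(x, y | q). *)
Definition gen_al_salam_carlitz (a b : list C) (q : C) (n : nat) (x y : C) : C :=
  sum_n (fun k => qbinom q n k * (qpochs a q k / qpochs b q k)
                  * x ^ k * y ^ (n - k)) n.

(* phi_n^(alpha)(mu | q). *)
Definition hahn (alpha q : C) (n : nat) (mu : C) : C :=
  sum_n (fun k => qbinom q n k * qpoch alpha q k * mu ^ k) n.

Definition bilinear_lhs_term
    (a b : list C) (q x y alpha mu t : C) (n : nat) : C :=
  gen_al_salam_carlitz a b q n x y * hahn alpha q n mu * (t ^ n / qpoch q q n).

Definition bilinear_rhs_factor (q y alpha mu t : C) : C :=
  qpoch_inf (alpha * mu * y * t) q / qpochs_inf (mu * y * t :: y * t :: nil) q.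

Definition bilinear_rhs_term
    (a b : list C) (q x y alpha mu t : C) (j : nat) : C :=
  qpochs a q j / qpochs (q :: b) q j * (x * t) ^ j
  * qhyper (/ q ^ j :: alpha :: y * t :: nil) (alpha * mu * y * t :: nil)
           q (mu * q ^ j).

(* Main.v *)
Require Import Defs.
From Stdlib Require Import Lra Lia.

(** Write [z = x t], [w = y t], [h_n] for the Hahn polynomials at [mu], and
    [c_k = (a; q)_k / ((q; q)_k (b; q)_k) z ^ k].  The left-hand term of index [n] is
    [h_n] times the Cauchy product of [c_k] and [d_m = w ^ m / (q; q)_m]
    ([bilinear_lhs_term_convolution]).  Summing over [m] first turns the bilinear
    series into the sum of [c_k G_k(w)], where [G_k(w)] is the sum over [m] of
    [d_m h_(k+m)] ([shifted_sum]).  The theorem thus has an algebraic part, the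
    evaluation of [G_k], and an analytic part, the change of order of summation.

    Evaluation.  By the q-Pascal rule the Hahn polynomials satisfy a three-term
    recurrence, which makes [G_0] satisfy
    [(1 - w) (1 - mu w) G_0(w) = (1 - al mu w) G_0(w q)].  Iterating gives [G_0] as
    the prefactor of the theorem ([hahn_gf]).  Moreover
    [G_j(w) - w G_(j+1)(w) = G_j(w q)], and the prefactor times the terminating 3Phi1
    satisfies the same relation ([terminating_3phi1_contiguous]), so the two agree
    for every [j] by induction ([hahn_shifted_sum]).

    Rearrangement.  If [c = O(xi ^ k)] and [h = O(r ^ n)] with [xi r < 1] and
    [|w| r < 1], the partial sums of the two series differ by a null sequence
    ([rearrangement]), so that one converges exactly when the other does, with the
    same sum.  For [max (1, |mu|) |z| < 1] such rates are immediate, and they also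
    yield the convergence of the bilinear series.

    The equivalence puts no bound on [z], so it remains to find rates whenever
    one of the series converges ([compatible_rates]).  A terminating [c] is
    bounded at every rate.  Otherwise the terms of the convergent series tend to zero, and
    [c_k] is asymptotic to a nonzero multiple of [z ^ k].  This forces
    [z ^ n h_n] to tend to zero: on the right through [null_of_shifted_sum_null],
    which inverts the passage from [h] to [G], and on the left through
    [null_of_product_null], because the Cauchy product is itself asymptotic to a
    nonzero multiple of [z ^ n].  Finally the recurrence gives a gap: if
    [z ^ n h_n] tends to zero, it does so exponentially fast ([hahn_decay]).  The
    generating function of the [h_n / (q; q)_n] is meromorphic, and the absence of
    poles in a closed disc enlarges its radius of convergence. *)

(** * Convergence of complex sequences *)

(** Convergence is phrased through the modulus, so that it reduces to real limits. *)
Definition converges (u : nat -> C) (l : C) : Prop :=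
  is_lim_seq (fun n => Cmod (u n - l)) 0.

(** The modulus is the norm of [C] as a normed module over itself, so the
    filter-based series and the modulus-based limit agree. *)
Lemma is_series_converges (a : nat -> C) (l : C) :
  is_series a l <-> converges (sum_n a) l.
Proof.
  unfold is_series, converges.
  pose proof (filterlim_locally_ball_norm (U := C_NormedModule)
                (F := eventually) (sum_n a) l) as E.
  split.
  - intros H0. pose proof (proj1 E H0) as H. apply is_lim_seq_spec. intros eps.
    destruct (H eps) as [N HN]. exists N. intros n Hn.
    rewrite Rminus_0_r, Rabs_pos_eq by apply Cmod_ge_0.
    exact (HN n Hn).
  - intros H. apply (proj2 E). intros eps. apply is_lim_seq_spec in H.
    destruct (H eps) as [N HN]. exists N. intros n Hn.
    specialize (HN n Hn). rewrite Rminus_0_r, Rabs_pos_eq in HN by apply Cmod_ge_0.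
    exact HN.
Qed.

Lemma converges_ext (u v : nat -> C) (l : C) :
  (forall n, u n = v n) -> converges u l -> converges v l.
Proof.
  intros E. apply is_lim_seq_ext. intros n. now rewrite E.
Qed.

Lemma converges_squeeze (u : nat -> C) (l : C) (b : nat -> R) :
  (forall n, (Cmod (u n - l) <= b n)%R) -> is_lim_seq b 0 -> converges u l.
Proof.
  intros H Hb. apply is_lim_seq_le_le with (fun _ => 0%R) b; auto.
  - intros n; split; [apply Cmod_ge_0 | apply H].
  - apply is_lim_seq_const.
Qed.

Lemma converges_plus (u v : nat -> C) (l m : C) :
  converges u l -> converges v m -> converges (fun n => u n + v n) (l + m).
Proof.
  intros Hu Hv.
  apply converges_squeeze with (fun n => Cmod (u n - l) + Cmod (v n - m))%R.
  - intros n. replace (u n + v n - (l + m)) with ((u n - l) + (v n - m)) by ring.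
    apply Cmod_triangle.
  - replace (Finite 0) with (Finite (0 + 0)) by (f_equal; ring).
    now apply is_lim_seq_plus'.
Qed.

Lemma converges_const (c : C) : converges (fun _ => c) c.
Proof.
  apply converges_squeeze with (fun _ => 0%R); [|apply is_lim_seq_const].
  intros _. replace (c - c) with (RtoC 0) by ring. rewrite Cmod_0. lra.
Qed.

Lemma converges_scal (c : C) (u : nat -> C) (l : C) :
  converges u l -> converges (fun n => c * u n) (c * l).
Proof.
  intros H. apply converges_squeeze with (fun n => Cmod c * Cmod (u n - l))%R.
  - intros n. replace (c * u n - c * l) with (c * (u n - l)) by ring.
    rewrite Cmod_mult. lra.
  - replace (Finite 0) with (Finite (Cmod c * 0)) by (f_equal; ring).
    now apply is_lim_seq_mult'; [apply is_lim_seq_const|].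
Qed.

Lemma converges_Cmod (u : nat -> C) (l : C) :
  converges u l -> is_lim_seq (fun n => Cmod (u n)) (Cmod l).
Proof.
  intros H.
  apply is_lim_seq_le_le with (fun n => Cmod l - Cmod (u n - l))%R
    (fun n => Cmod l + Cmod (u n - l))%R.
  - intros n. split.
    + pose proof (Cmod_triangle (u n) (l - u n)).
      replace (u n + (l - u n)) with l in H0 by ring.
      replace (l - u n) with (- (u n - l)) in H0 by ring.
      rewrite Cmod_opp in H0. lra.
    + pose proof (Cmod_triangle l (u n - l)).
      replace (l + (u n - l)) with (u n) in H0 by ring. lra.
  - replace (Finite (Cmod l)) with (Finite (Cmod l - 0)) by (f_equal; ring).
    apply is_lim_seq_minus'; [apply is_lim_seq_const | exact H].
  - replace (Finite (Cmod l)) with (Finite (Cmod l + 0)) by (f_equal; ring).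
    apply is_lim_seq_plus'; [apply is_lim_seq_const | exact H].
Qed.

Lemma converges_mult (u v : nat -> C) (l m : C) :
  converges u l -> converges v m -> converges (fun n => u n * v n) (l * m).
Proof.
  intros Hu Hv.
  apply converges_squeeze
    with (fun n => Cmod (u n) * Cmod (v n - m) + Cmod m * Cmod (u n - l))%R.
  - intros n.
    replace (u n * v n - l * m) with (u n * (v n - m) + m * (u n - l)) by ring.
    eapply Rle_trans; [apply Cmod_triangle|]. rewrite !Cmod_mult. lra.
  - replace (Finite 0) with (Finite (Cmod l * 0 + Cmod m * 0)) by (f_equal; ring).
    apply is_lim_seq_plus'; apply is_lim_seq_mult'; auto.
    + now apply converges_Cmod.
    + apply is_lim_seq_const.
Qed.

Lemma converges_of_difference_null (x y : nat -> C) (l : C) :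
  converges (fun n => x n - y n) 0 -> (converges x l <-> converges y l).
Proof.
  intros H. split; intros Hx.
  - replace l with (l + - (1) * 0) by ring.
    apply converges_ext with (fun n => x n + - (1) * (x n - y n)).
    + intros n. ring.
    + apply converges_plus; [exact Hx|now apply converges_scal].
  - replace l with (l + 0) by ring.
    apply converges_ext with (fun n => y n + (x n - y n)).
    + intros n. ring.
    + now apply converges_plus.
Qed.

Lemma converges_unique (u : nat -> C) (l m : C) :
  converges u l -> converges u m -> l = m.
Proof.
  intros Hl Hm.
  assert (H : converges (fun n => u n + -(1) * u n) (l + -(1) * m))
    by (apply converges_plus; [|apply converges_scal]; assumption).
  apply converges_Cmod in H.
  apply is_lim_seq_ext with (v := fun _ => 0%R) in H.
  - apply is_lim_seq_unique in H. rewrite Lim_seq_const in H.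
    injection H as H. symmetry in H. apply Cmod_eq_0 in H.
    replace l with (l + -(1) * m + m) by ring. rewrite H. ring.
  - intros n. replace (u n + -(1) * u n) with (RtoC 0) by ring. apply Cmod_0.
Qed.

Lemma converges_S (u : nat -> C) (l : C) :
  converges u l <-> converges (fun n => u (S n)) l.
Proof.
  unfold converges. split.
  - apply (is_lim_seq_incr_1 (fun n => Cmod (u n - l))).
  - apply (is_lim_seq_incr_1 (fun n => Cmod (u n - l))).
Qed.

(** Dividing by a sequence with a nonzero limit is legitimate for all large
    indices, even if the sequence has zeros early on. *)
Lemma converges_cancel (a b : nat -> C) (l : C) :
  l <> 0 -> converges a l -> converges (fun n => a n * b n) 0 -> converges b 0.
Proof.
  intros Hl Ha Hab.
  assert (HlC : (0 < Cmod l)%R) by now apply Cmod_gt_0.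
  pose proof (converges_Cmod _ _ Ha) as HaC.
  apply converges_Cmod in Hab. rewrite Cmod_0 in Hab.
  unfold converges.
  apply is_lim_seq_ext_loc with (fun n => Cmod (a n * b n) * / Cmod (a n))%R.
  - apply is_lim_seq_spec in HaC. destruct (HaC (mkposreal _ HlC)) as [N HN].
    exists N. intros n Hn. specialize (HN n Hn). simpl in HN. apply Rabs_def2 in HN.
    replace (b n - 0) with (b n) by ring. rewrite Cmod_mult. field. lra.
  - replace (Finite 0) with (Finite (0 * / Cmod l)) by (f_equal; ring).
    apply is_lim_seq_mult'; [exact Hab|].
    apply (is_lim_seq_inv _ (Finite (Cmod l))); [exact HaC|].
    intros E. injection E as E. lra.
Qed.

Lemma Cinv_neq_0 (z : C) : z <> 0 -> / z <> 0.
Proof.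
  intros Hz E. apply C1_nz. rewrite <- (Cinv_l z Hz), E. ring.
Qed.

Lemma converges_inv (u : nat -> C) (l : C) :
  (forall n, u n <> 0) -> l <> 0 -> converges u l ->
  converges (fun n => / u n) (/ l).
Proof.
  intros Hu0 Hl0 Hu.
  assert (Hl : (0 < Cmod l)%R) by now apply Cmod_gt_0.
  pose proof (converges_Cmod u l Hu) as HC. 
  unfold converges.
  apply is_lim_seq_ext with (fun n => Cmod (u n - l) * / (Cmod (u n) * Cmod l))%R.
  - intros n. rewrite <- Cmod_mult, <- Cmod_inv, <- Cmod_mult
      by (apply Cmult_neq_0; auto).
    replace (/ u n - / l) with (- ((u n - l) * / (u n * l)))
      by (field; auto). now rewrite Cmod_opp.
  - replace (Finite 0) with (Finite (0 * / (Cmod l * Cmod l))) by (f_equal; ring).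
    apply is_lim_seq_mult'; [exact Hu|].
    apply (is_lim_seq_inv _ (Finite (Cmod l * Cmod l))).
    + apply is_lim_seq_mult'; [exact HC|apply is_lim_seq_const].
    + intros E. injection E as E. nra.
Qed.

Lemma Re_converges (u : nat -> C) (l : C) :
  converges u l -> is_lim_seq (fun n => Re (u n)) (Re l).
Proof.
  intros H. apply is_lim_seq_spec in H. apply is_lim_seq_spec.
  intros eps. destruct (H eps) as [N HN]. exists N. intros n Hn.
  specialize (HN n Hn). rewrite Rminus_0_r, Rabs_pos_eq in HN by apply Cmod_ge_0.
  eapply Rle_lt_trans; [|exact HN]. exact (re_le_Cmod (u n - l)).
Qed.

Lemma Im_converges (u : nat -> C) (l : C) :
  converges u l -> is_lim_seq (fun n => Im (u n)) (Im l).
Proof.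
  intros H. apply is_lim_seq_spec in H. apply is_lim_seq_spec.
  intros eps. destruct (H eps) as [N HN]. exists N. intros n Hn.
  specialize (HN n Hn). rewrite Rminus_0_r, Rabs_pos_eq in HN by apply Cmod_ge_0.
  eapply Rle_lt_trans; [|exact HN].
  eapply Rle_trans; [|exact (Rmax_Cmod (u n - l))]. apply Rmax_r.
Qed.

Lemma CLim_seq_unique (u : nat -> C) (l : C) : converges u l -> CLim_seq u = l.
Proof.
  intros H. unfold CLim_seq.
  rewrite (is_lim_seq_unique _ _ (Re_converges u l H)).
  rewrite (is_lim_seq_unique _ _ (Im_converges u l H)).
  now destruct l.
Qed.

(** * Finite sums and series *)

Lemma csum_S (u : nat -> C) (n : nat) :
  sum_n u (S n) = (sum_n u n : C) + u (S n) :> C.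
Proof. exact (sum_Sn u n). Qed.

Lemma csum_0 (u : nat -> C) : sum_n u 0 = u 0%nat :> C.
Proof. exact (sum_O u). Qed.

Lemma csum_ext (u v : nat -> C) (n : nat) :
  (forall k, (k <= n)%nat -> u k = v k) -> sum_n u n = sum_n v n :> C.
Proof. apply (sum_n_ext_loc u v n). Qed.

Lemma csum_scal (c : C) (u : nat -> C) (n : nat) :
  sum_n (fun k => c * u k) n = c * (sum_n u n : C) :> C.
Proof. apply (sum_n_mult_l (K := C_Ring) c u n). Qed.

Lemma csum_plus (u v : nat -> C) (n : nat) :
  sum_n (fun k => u k + v k) n = (sum_n u n : C) + (sum_n v n : C) :> C.
Proof. apply (sum_n_plus u v n). Qed.

Lemma csum_S_left (u : nat -> C) (n : nat) :
  sum_n u (S n) = u 0%nat + (sum_n (fun k => u (S k)) n : C) :> C.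
Proof.
  induction n as [|n IH].
  - now rewrite csum_S, !csum_0.
  - rewrite csum_S, IH, (csum_S (fun k => u (S k))). ring.
Qed.

Lemma csum_rev (v : nat -> C) (n : nat) :
  sum_n (fun k => v (n - k)%nat) n = sum_n v n :> C.
Proof.
  induction n as [|n IH].
  - now rewrite !csum_0.
  - rewrite csum_S_left, csum_S.
    change (fun k => v (S n - S k)%nat) with (fun k => v (n - k)%nat).
    rewrite IH. rewrite Nat.sub_0_r. ring.
Qed.

Lemma csum_pair (u v : nat -> R) (n : nat) :
  sum_n (fun k => (u k, v k) : C) n = (sum_n u n, sum_n v n) :> C.
Proof.
  induction n as [|n IH].
  - now rewrite csum_0, !sum_O.
  - now rewrite csum_S, IH, !sum_Sn.
Qed.

Lemma CSeries_unique (a : nat -> C) (l : C) : is_series a l -> CSeries a = l.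
Proof.
  intros H. apply is_series_converges in H.
  rewrite <- (CLim_seq_unique _ _ H). unfold CLim_seq, CSeries, Series.
  assert (E : forall n, sum_n a n
              = (sum_n (fun k => Re (a k)) n, sum_n (fun k => Im (a k)) n) :> C).
  { intros n. rewrite <- csum_pair. apply csum_ext. intros k _. now destruct (a k). }
  f_equal; f_equal; apply Lim_seq_ext; intros n; now rewrite E.
Qed.

Lemma rsum_scal (c : R) (u : nat -> R) (n : nat) :
  (sum_n (fun k => c * u k) n = c * sum_n u n :> R)%R.
Proof. apply (sum_n_mult_l (K := R_Ring) c u n). Qed.

Lemma Cmod_csum_le_sum (u : nat -> C) (b : nat -> R) (n : nat) :
  (forall k, (k <= n)%nat -> (Cmod (u k) <= b k)%R) ->
  (Cmod (sum_n u n) <= sum_n b n)%R.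
Proof.
  induction n as [|n IH]; intros H.
  - rewrite csum_0, sum_O. now apply H.
  - rewrite csum_S, sum_Sn. change plus with Rplus.
    eapply Rle_trans; [apply Cmod_triangle|].
    apply Rplus_le_compat; [apply IH; intros; apply H; lia|now apply H].
Qed.

Lemma Cmod_csum_le (u : nat -> C) (B : R) (n : nat) :
  (forall k, (k <= n)%nat -> (Cmod (u k) <= B)%R) ->
  (Cmod (sum_n u n) <= INR (S n) * B)%R.
Proof. rewrite <- (sum_n_const n B). apply Cmod_csum_le_sum. Qed.

Lemma csum_eventually_zero (u : nat -> C) (n m : nat) :
  (forall k, (n < k)%nat -> u k = 0) -> (n <= m)%nat ->
  sum_n u m = sum_n u n :> C.
Proof.
  intros H Hm. induction Hm as [|m Hm IH]; [easy|].
  rewrite csum_S, IH, H by lia. ring.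
Qed.

Lemma is_series_finite (u : nat -> C) (n : nat) :
  (forall k, (n < k)%nat -> u k = 0) -> is_series u (sum_n u n : C).
Proof.
  intros H. apply is_series_converges.
  unfold converges. apply is_lim_seq_ext_loc with (fun _ => 0%R).
  - exists n. intros m Hm. rewrite (csum_eventually_zero u n m) by assumption.
    replace (_ - _) with (RtoC 0) by ring. now rewrite Cmod_0.
  - apply is_lim_seq_const.
Qed.

Lemma is_series_eq (a : nat -> C) (l m : C) :
  is_series a l -> is_series a m -> l = m.
Proof.
  intros Hl Hm. apply is_series_converges in Hl, Hm.
  now apply (converges_unique (sum_n a)).
Qed.

Lemma is_series_cext (a b : nat -> C) (l : C) :
  (forall n, a n = b n) -> is_series a l -> is_series b l.
Proof. apply (is_series_ext (V := C_NormedModule)). Qed.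

Lemma is_series_terms_null (a : nat -> C) (l : C) : is_series a l -> converges a 0.
Proof.
  intros H. apply is_series_converges in H.
  apply converges_S.
  replace (RtoC 0) with (l + - (1) * l) by ring.
  apply converges_ext with (fun n => (sum_n a (S n) : C) + - (1) * (sum_n a n : C)).
  - intros n. rewrite csum_S. ring.
  - apply converges_plus; [|now apply converges_scal].
    now apply (converges_S (sum_n a)).
Qed.

Lemma is_series_lin (c : C) (a b : nat -> C) (l m : C) :
  is_series a l -> is_series b m ->
  is_series (fun n => a n + c * b n) (l + c * m).
Proof.
  intros Ha Hb. apply (is_series_plus a (fun n => c * b n)); [exact Ha|].
  exact (is_series_scal c b m Hb).
Qed.

Lemma is_series_shift (a : nat -> C) (l : C) :
  is_series (fun n => a (S n)) l -> is_series a (a 0%nat + l).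
Proof.
  intros H. apply is_series_converges. apply is_series_converges in H.
  apply converges_S.
  apply converges_ext with (fun n => a 0%nat + (sum_n (fun k => a (S k)) n : C)).
  - intros n. symmetry. apply csum_S_left.
  - now apply converges_plus; [apply converges_const|].
Qed.

(** * Geometric bounds *)

Definition geom_bounded (u : nat -> C) (r : R) : Prop :=
  exists K : R, (0 <= K)%R /\ forall n, (Cmod (u n) <= K * r ^ n)%R.

Lemma pow_le_one (r : R) (n : nat) : (0 <= r <= 1)%R -> (0 <= r ^ n <= 1)%R.
Proof.
  intros H. split; [now apply pow_le|]. rewrite <- (pow1 n). now apply pow_incr.
Qed.

(** With [p = r / s < 1], the bound [(n + 1) p ^ n <= 1 + p + ... + p ^ n]
    reduces the claim to a geometric series.  This absorbs the number of terms of
    a sum into a slightly larger ratio. *)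
Lemma linear_geom_bounded (r s : R) :
  (0 <= r < s)%R ->
  exists K, (0 <= K)%R /\ forall n, (INR (S n) * r ^ n <= K * s ^ n)%R.
Proof.
  intros [Hr Hs]. set (p := (r / s)%R).
  assert (Hp : (0 <= p < 1)%R).
  { unfold p. split.
    - apply Rdiv_le_0_compat; lra.
    - apply Rmult_lt_reg_r with s; [lra|]. field_simplify; lra. }
  assert (Hn : forall n, (INR (S n) * p ^ n <= (1 - p ^ S n) / (1 - p))%R).
  { intros n. apply Rmult_le_reg_r with (1 - p)%R; [lra|].
    replace ((1 - p ^ S n) / (1 - p) * (1 - p))%R with (1 - p ^ S n)%R by (field; lra).
    induction n as [|n IH].
    - simpl. lra.
    - rewrite S_INR. pose proof (pow_le_one p (S n) ltac:(lra)).
      replace ((INR (S n) + 1) * p ^ S n * (1 - p))%R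
        with (p * (INR (S n) * p ^ n * (1 - p)) + p ^ S n * (1 - p))%R
        by (simpl pow; ring).
      assert (p * (INR (S n) * p ^ n * (1 - p)) <= p * (1 - p ^ S n))%R
        by (apply Rmult_le_compat_l; lra).
      change (p ^ S (S n))%R with (p * p ^ S n)%R.
      nra. }
  exists (/ (1 - p))%R. split.
  { left. apply Rinv_0_lt_compat. lra. }
  intros n.
  replace (r ^ n)%R with (p ^ n * s ^ n)%R.
  2:{ unfold p. rewrite <- Rpow_mult_distr. f_equal. field. lra. }
  rewrite <- Rmult_assoc. apply Rmult_le_compat_r; [apply pow_le; lra|].
  eapply Rle_trans; [apply Hn|]. unfold Rdiv.
  rewrite <- (Rmult_1_l (/ (1 - p))) at 2.
  apply Rmult_le_compat_r.
  - left. apply Rinv_0_lt_compat. lra.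
  - pose proof (pow_le_one p (S n) ltac:(lra)). lra.
Qed.

Lemma geom_bounded_mult (u v : nat -> C) (r s : R) :
  geom_bounded u r -> geom_bounded v s -> geom_bounded (fun n => u n * v n) (r * s).
Proof.
  intros [K [HK Hu]] [L [HL Hv]]. exists (K * L)%R. split; [nra|].
  intros n. rewrite Cmod_mult, Rpow_mult_distr.
  replace (K * L * (r ^ n * s ^ n))%R with ((K * r ^ n) * (L * s ^ n))%R by ring.
  apply Rmult_le_compat; auto using Cmod_ge_0.
Qed.

Lemma geom_bounded_pow (z : C) : geom_bounded (fun n => z ^ n) (Cmod z).
Proof.
  exists 1%R. split; [lra|]. intros n. rewrite Cmod_pow. lra.
Qed.

Lemma geom_bounded_S (u : nat -> C) (r : R) :
  (0 <= r)%R -> geom_bounded u r -> geom_bounded (fun n => u (S n)) r.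
Proof.
  intros Hr [K [HK Hu]]. exists (K * r)%R. split; [nra|].
  intros n. specialize (Hu (S n)). simpl in Hu. lra.
Qed.

Lemma geom_bounded_lin (a b : C) (u v : nat -> C) (r : R) :
  geom_bounded u r -> geom_bounded v r ->
  geom_bounded (fun n => a * u n + b * v n) r.
Proof.
  intros [K [HK Hu]] [L [HL Hv]].
  pose proof (Cmod_ge_0 a). pose proof (Cmod_ge_0 b).
  exists (Cmod a * K + Cmod b * L)%R. split; [nra|]. intros n.
  eapply Rle_trans; [apply Cmod_triangle|]. rewrite !Cmod_mult.
  specialize (Hu n). specialize (Hv n). nra.
Qed.

Lemma converges_bounded (u : nat -> C) (l : C) : converges u l -> geom_bounded u 1.
Proof.
  intros H. apply converges_Cmod in H. apply is_lim_seq_Reals in H.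
  destruct (maj_by_pos _ (exist _ _ H)) as [K [HK Hu]].
  exists K. split; [lra|]. intros n. specialize (Hu n).
  rewrite pow1, Rmult_1_r. rewrite Rabs_pos_eq in Hu by apply Cmod_ge_0. exact Hu.
Qed.

(** Boundedness of [z ^ n * u n] is the form in which a null sequence delivers
    a geometric bound. *)
Lemma geom_bounded_unscale (u : nat -> C) (z : C) :
  z <> 0 -> geom_bounded (fun n => z ^ n * u n) 1 -> geom_bounded u (/ Cmod z).
Proof.
  intros Hz [K [HK Hu]]. exists K. split; [easy|]. intros n. specialize (Hu n).
  rewrite pow1, Rmult_1_r, Cmod_mult, Cmod_pow in Hu.
  apply Cmod_gt_0 in Hz. pose proof (pow_lt _ n Hz) as Hzn.
  apply Rmult_le_reg_l with (Cmod z ^ n)%R; [easy|].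
  rewrite pow_inv. replace (Cmod z ^ n * (K * / Cmod z ^ n))%R with K by (field; lra).
  exact Hu.
Qed.

Lemma geom_bounded_eventually_zero (u : nat -> C) (N : nat) (r : R) :
  (0 < r)%R -> (forall n, (N < n)%nat -> u n = 0) -> geom_bounded u r.
Proof.
  intros Hr H.
  assert (HB : exists B, (0 <= B)%R /\ forall n, (n <= N)%nat -> (Cmod (u n) <= B * r ^ n)%R).
  { clear H. induction N as [|N [B [HB IH]]].
    - exists (Cmod (u 0%nat)). split; [apply Cmod_ge_0|]. intros n Hn.
      replace n with 0%nat by lia. simpl. lra.
    - pose proof (pow_lt r (S N) Hr) as Hp.
      exists (Rmax B (Cmod (u (S N)) / r ^ S N)). split.
      + eapply Rle_trans; [exact HB|apply Rmax_l].
      + intros n Hn. destruct (Nat.eq_dec n (S N)) as [->|Hne].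
        * replace (Cmod (u (S N))) with (Cmod (u (S N)) / r ^ S N * r ^ S N)%R at 1
            by (field; lra).
          apply Rmult_le_compat_r; [lra|apply Rmax_r].
        * eapply Rle_trans; [apply IH; lia|].
          apply Rmult_le_compat_r; [apply pow_le; lra|apply Rmax_l]. }
  destruct HB as [B [HB Hn]]. exists B. split; [easy|]. intros n.
  destruct (le_lt_dec n N) as [Hle|Hlt]; [now apply Hn|].
  rewrite H by easy. rewrite Cmod_0. apply Rmult_le_pos; [easy|]. apply pow_le; lra.
Qed.

Lemma room_below (m t : R) :
  (0 <= m)%R -> (0 <= t)%R -> (m * t < 1)%R -> exists r, (m < r)%R /\ (r * t < 1)%R.
Proof.
  intros Hm Ht H. exists (m + (1 - m * t) / (2 * (t + 1)))%R. split.
  - assert (0 < (1 - m * t) / (2 * (t + 1)))%R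
      by (apply Rdiv_lt_0_compat; lra). lra.
  - replace ((m + (1 - m * t) / (2 * (t + 1))) * t)%R
      with (m * t + (1 - m * t) / 2 - (1 - m * t) / (2 * (t + 1)))%R by (field; lra).
    assert (0 < (1 - m * t) / (2 * (t + 1)))%R
      by (apply Rdiv_lt_0_compat; lra). lra.
Qed.

Lemma geom_null (K r : R) : (0 <= r < 1)%R -> is_lim_seq (fun n => K * r ^ n)%R 0.
Proof.
  intros Hr. replace (Finite 0) with (Finite (K * 0)) by (f_equal; ring).
  apply is_lim_seq_mult'; [apply is_lim_seq_const|].
  apply is_lim_seq_geom. rewrite Rabs_pos_eq; lra.
Qed.

Lemma geom_bounded_ex_series (u : nat -> C) (r : R) :
  (0 <= r < 1)%R -> geom_bounded u r -> ex_series u.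
Proof.
  intros Hr [K [HK Hu]].
  apply (ex_series_le (V := C_CompleteNormedModule) u (fun n => K * r ^ n)%R).
  - intros n. exact (Hu n).
  - apply (ex_series_scal (V := R_NormedModule) K (fun n => r ^ n)%R).
    apply ex_series_geom. rewrite Rabs_pos_eq; lra.
Qed.

(** The explicit constant matters: it makes the tails of a family of series
    uniformly small in the parameters of the family. *)
Lemma series_tail_le (u : nat -> C) (l : C) (K r : R) (M : nat) :
  (0 <= r < 1)%R -> (0 <= K)%R ->
  (forall n, (Cmod (u n) <= K * r ^ n)%R) -> is_series u l ->
  (Cmod (l - (sum_n u M : C)) <= K * r ^ S M / (1 - r))%R.
Proof.
  intros Hr HK Hu Hl. apply is_series_converges in Hl.
  assert (Hp : forall p,
    (Cmod ((sum_n u (p + M) : C) - (sum_n u M : C))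
       <= K * r ^ S M / (1 - r) * (1 - r ^ p))%R).
  { induction p as [|p IH].
    - change (0 + M)%nat with M. replace ((sum_n u M : C) - (sum_n u M : C)) with (RtoC 0) by ring.
      rewrite Cmod_0. simpl. lra.
    - change (S p + M)%nat with (S (p + M)). rewrite csum_S.
      replace ((sum_n u (p + M) : C) + u (S (p + M)) - (sum_n u M : C))
        with (((sum_n u (p + M) : C) - (sum_n u M : C)) + u (S (p + M))) by ring.
      eapply Rle_trans; [apply Cmod_triangle|].
      specialize (Hu (S (p + M))).
      replace (S (p + M)) with (p + S M)%nat in Hu by lia.
      replace (S (p + M)) with (p + S M)%nat by lia.
      rewrite pow_add in Hu.
      replace (K * r ^ S M / (1 - r) * (1 - r ^ S p))%R
        with (K * r ^ S M / (1 - r) * (1 - r ^ p) + K * (r ^ p * r ^ S M))%R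
        by (simpl; field; lra).
      lra. }
  assert (HB : (0 <= K * r ^ S M / (1 - r))%R).
  { apply Rdiv_le_0_compat; [|lra]. apply Rmult_le_pos; [easy|]. apply pow_le; lra. }
  apply (is_lim_seq_incr_n _ M) in Hl.
  assert (HL : is_lim_seq
    (fun n => K * r ^ S M / (1 - r) + Cmod ((sum_n u (n + M) : C) - l))%R
    (K * r ^ S M / (1 - r) + 0)%R).
  { apply is_lim_seq_plus'; [apply is_lim_seq_const|exact Hl]. }
  assert (H : Rbar_le (Cmod (l - (sum_n u M : C))) (K * r ^ S M / (1 - r) + 0)%R).
  { eapply is_lim_seq_le; [|apply is_lim_seq_const|exact HL].
    intros n. simpl.
    replace (l - (sum_n u M : C))
      with (((sum_n u (n + M) : C) - (sum_n u M : C))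
            + - ((sum_n u (n + M) : C) - l)) by ring.
    eapply Rle_trans; [apply Cmod_triangle|]. rewrite Cmod_opp.
    specialize (Hp n). pose proof (pow_le_one r n ltac:(lra)).
    assert (K * r ^ S M / (1 - r) * (1 - r ^ n) <= K * r ^ S M / (1 - r))%R by nra.
    simpl in *. lra. }
  simpl in H. simpl. lra.
Qed.

(** * The q-shifted factorial *)

Lemma one_minus_neq0 (z : C) : z <> 1 -> 1 - z <> 0.
Proof.
  intros H E. apply H. replace z with (1 - (1 - z)) by ring. rewrite E. ring.
Qed.

Lemma Cmod_lt1_neq1 (z : C) : (Cmod z < 1)%R -> z <> 1.
Proof. intros H E. rewrite E, Cmod_1 in H. lra. Qed.

Lemma Cmod_mult_pow_le (w q : C) (k : nat) :
  (Cmod q < 1)%R -> (Cmod (w * q ^ k) <= Cmod w)%R.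
Proof.
  intros Hq. rewrite Cmod_mult, Cmod_pow.
  pose proof (Cmod_ge_0 w). pose proof (Cmod_ge_0 q).
  pose proof (pow_le_one (Cmod q) k ltac:(lra)). nra.
Qed.

Lemma mult_pow_neq1 (w q : C) (k : nat) :
  (Cmod q < 1)%R -> (Cmod w < 1)%R -> w * q ^ k <> 1.
Proof.
  intros Hq Hw. apply Cmod_lt1_neq1.
  pose proof (Cmod_mult_pow_le w q k Hq). lra.
Qed.

Lemma qpoch_S_left (a q : C) (n : nat) :
  qpoch a q (S n) = (1 - a) * qpoch (a * q) q n.
Proof.
  induction n as [|n IH].
  - simpl. ring.
  - change (qpoch a q (S (S n))) with (qpoch a q (S n) * (1 - a * q ^ S n)).
    rewrite IH. change (qpoch (a * q) q (S n))
      with (qpoch (a * q) q n * (1 - a * q * q ^ n)).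
    rewrite Cpow_S. ring.
Qed.

Lemma qpoch_neq0 (a q : C) (n : nat) :
  (forall k, a * q ^ k <> 1) -> qpoch a q n <> 0.
Proof.
  intros H. induction n as [|n IH]; simpl.
  - apply C1_nz.
  - apply Cmult_neq_0; [easy|]. apply one_minus_neq0, H.
Qed.

Lemma qq_neq1 (q : C) : (Cmod q < 1)%R -> forall k, q * q ^ k <> 1.
Proof. intros Hq k. now apply mult_pow_neq1. Qed.

(** An upper bound for the product of the factors [1 + x r ^ k] with [k < n],
    by [1 + t <= exp t] and the closed form of the geometric sum in the exponent. *)
Definition exp_geom (x r : R) (n : nat) : R :=
  exp (x * (1 - r ^ n) / (1 - r)).

Lemma exp_geom_0 (x r : R) : (r < 1)%R -> exp_geom x r 0 = 1%R.
Proof.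
  intros Hr. unfold exp_geom.
  replace (x * (1 - r ^ 0) / (1 - r))%R with 0%R by (simpl; field; lra).
  apply exp_0.
Qed.

Lemma exp_geom_S (x r : R) (n : nat) :
  (r < 1)%R -> (exp_geom x r n * (1 + x * r ^ n) <= exp_geom x r (S n))%R.
Proof.
  intros Hr. unfold exp_geom.
  replace (x * (1 - r ^ S n) / (1 - r))%R
    with (x * (1 - r ^ n) / (1 - r) + x * r ^ n)%R by (simpl; field; lra).
  rewrite exp_plus. apply Rmult_le_compat_l; [left; apply exp_pos|].
  apply exp_ineq1_le.
Qed.

Lemma exp_geom_le (x r : R) (n : nat) :
  (0 <= x)%R -> (0 <= r < 1)%R -> (exp_geom x r n <= exp (x / (1 - r)))%R.
Proof.
  intros Hx Hr. unfold exp_geom.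
  assert (Hle : (x * (1 - r ^ n) / (1 - r) <= x / (1 - r))%R).
  2:{ destruct Hle as [Hlt|E]; [left; now apply exp_increasing|rewrite E; lra]. }
  unfold Rdiv. apply Rmult_le_compat_r.
  - left. apply Rinv_0_lt_compat. lra.
  - pose proof (pow_le_one r n ltac:(lra)). nra.
Qed.

Lemma qpoch_bounded (a q : C) :
  (Cmod q < 1)%R ->
  exists K, (0 <= K)%R /\ forall n, (Cmod (qpoch a q n) <= K)%R.
Proof.
  intros Hq. pose proof (Cmod_ge_0 q). pose proof (Cmod_ge_0 a).
  assert (Hn : forall n, (Cmod (qpoch a q n) <= exp_geom (Cmod a) (Cmod q) n)%R).
  { induction n as [|n IH].
    - rewrite exp_geom_0 by easy. simpl. rewrite Cmod_1. lra.
    - simpl qpoch. rewrite Cmod_mult.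
      eapply Rle_trans; [|now apply exp_geom_S].
      apply Rmult_le_compat; auto using Cmod_ge_0.
      eapply Rle_trans; [apply Cmod_triangle|].
      rewrite Cmod_1, Cmod_opp, Cmod_mult, Cmod_pow. lra. }
  exists (exp (Cmod a / (1 - Cmod q))). split; [left; apply exp_pos|].
  intros n. eapply Rle_trans; [apply Hn|]. now apply exp_geom_le.
Qed.

(** The Weierstrass product inequality: the modulus of a product of factors
    [1 - t_k] is at least [1] minus the sum of the [|t_k|]. *)
Lemma qpoch_ge_small (a q : C) (n : nat) :
  (Cmod q < 1)%R -> (Cmod a / (1 - Cmod q) <= / 2)%R ->
  (1 - Cmod a * (1 - Cmod q ^ n) / (1 - Cmod q) <= Cmod (qpoch a q n))%R.
Proof.
  intros Hq Ha. pose proof (Cmod_ge_0 q). pose proof (Cmod_ge_0 a).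
  assert (Ha2 : (Cmod a <= / 2)%R).
  { apply Rmult_le_reg_r with (/ (1 - Cmod q))%R; [apply Rinv_0_lt_compat; lra|].
    fold (Cmod a / (1 - Cmod q))%R.
    eapply Rle_trans; [exact Ha|].
    assert (1 <= / (1 - Cmod q))%R
      by (rewrite <- Rinv_1 at 1; apply Rinv_le_contravar; lra). lra. }
  induction n as [|n IH].
  - simpl. rewrite Cmod_1.
    replace (Cmod a * (1 - 1) / (1 - Cmod q))%R with 0%R by (field; lra). lra.
  - simpl qpoch. rewrite Cmod_mult.
    replace (Cmod a * (1 - Cmod q ^ S n) / (1 - Cmod q))%R
      with (Cmod a * (1 - Cmod q ^ n) / (1 - Cmod q) + Cmod a * Cmod q ^ n)%R
      by (simpl; field; lra).
    pose proof (pow_le_one (Cmod q) n ltac:(lra)) as Hp.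
    set (s := (Cmod a * (1 - Cmod q ^ n) / (1 - Cmod q))%R) in *.
    assert (Hs : (0 <= s)%R).
    { unfold s. apply Rdiv_le_0_compat; [|lra]. apply Rmult_le_pos; lra. }
    assert (Hx : (0 <= Cmod a * Cmod q ^ n <= / 2)%R) by nra.
    assert (Hf : (1 - Cmod a * Cmod q ^ n <= Cmod (1 - a * q ^ n))%R).
    { pose proof (Cmod_triangle (1 - a * q ^ n) (a * q ^ n)) as T.
      replace (1 - a * q ^ n + a * q ^ n) with (RtoC 1) in T by ring.
      rewrite Cmod_1, Cmod_mult, Cmod_pow in T. lra. }
    pose proof (Cmod_ge_0 (qpoch a q n)).
    assert (Cmod (qpoch a q n) * (1 - Cmod a * Cmod q ^ n)
            <= Cmod (qpoch a q n) * Cmod (1 - a * q ^ n))%R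
      by (apply Rmult_le_compat_l; lra).
    nra.
Qed.

(** Splitting off first factors replaces [a] by [a q], [a q ^ 2], ..., which
    become small enough for the Weierstrass inequality; the finitely many factors
    split off are nonzero.  A uniform lower bound, rather than mere
    nonvanishing, is what makes the infinite product nonzero. *)
Lemma qpoch_ge (a q : C) :
  (Cmod q < 1)%R -> (forall k, a * q ^ k <> 1) ->
  exists d, (0 < d)%R /\ forall n, (d <= Cmod (qpoch a q n))%R.
Proof.
  intros Hq. pose proof (Cmod_ge_0 q) as Hq0.
  assert (HN : forall N a, (Cmod a * Cmod q ^ N / (1 - Cmod q) <= / 2)%R ->
     (forall k, a * q ^ k <> 1) ->
     exists d, (0 < d)%R /\ forall n, (d <= Cmod (qpoch a q n))%R).
  { clear a. induction N as [|N IH]; intros a Ha H.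
    - simpl in Ha. rewrite Rmult_1_r in Ha. exists (/ 2)%R. split; [lra|].
      intros n. eapply Rle_trans; [|now apply qpoch_ge_small].
      assert (Cmod a * (1 - Cmod q ^ n) / (1 - Cmod q)
              <= Cmod a / (1 - Cmod q))%R; [|lra].
      unfold Rdiv. apply Rmult_le_compat_r.
      + left. apply Rinv_0_lt_compat. lra.
      + pose proof (pow_le_one (Cmod q) n ltac:(lra)).
        pose proof (Cmod_ge_0 a). nra.
    - destruct (IH (a * q)) as [d [Hd Hdn]].
      + rewrite Cmod_mult.
        replace (Cmod a * Cmod q * Cmod q ^ N)%R with (Cmod a * Cmod q ^ S N)%R
          by (simpl; ring). exact Ha.
      + intros k. specialize (H (S k)). rewrite Cpow_S in H.
        now replace (a * q * q ^ k) with (a * (q * q ^ k)) by ring.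
      + assert (H1 : (0 < Cmod (1 - a))%R).
        { apply Cmod_gt_0. apply one_minus_neq0. specialize (H 0%nat).
          simpl in H. now rewrite Cmult_1_r in H. }
        exists (Rmin 1 (Cmod (1 - a) * d)). split.
        * apply Rmin_glb_lt; [lra|]. now apply Rmult_lt_0_compat.
        * intros [|n].
          -- simpl. rewrite Cmod_1. apply Rmin_l.
          -- rewrite qpoch_S_left, Cmod_mult.
             eapply Rle_trans; [apply Rmin_r|].
             apply Rmult_le_compat_l; [lra|apply Hdn]. }
  assert (HL : is_lim_seq (fun N => Cmod a * / (1 - Cmod q) * Cmod q ^ N)%R
                 (Cmod a * / (1 - Cmod q) * 0)%R).
  { apply is_lim_seq_mult'; [apply is_lim_seq_const|].
    apply is_lim_seq_geom. rewrite Rabs_pos_eq; lra. }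
  rewrite Rmult_0_r in HL. apply is_lim_seq_spec in HL.
  destruct (HL (mkposreal (/ 2) ltac:(lra))) as [N H].
  specialize (H N (le_n N)). simpl in H. rewrite Rminus_0_r in H.
  apply Rabs_def2 in H.
  (* [N] is so large that [|a q ^ N|] meets the Weierstrass condition. *)
  apply (HN N). unfold Rdiv. lra.
Qed.

(** Consecutive products differ by [a q ^ n] times a bounded factor, so the
    differences form an absolutely convergent series. *)
Lemma qpoch_converges (a q : C) :
  (Cmod q < 1)%R -> converges (qpoch a q) (qpoch_inf a q).
Proof.
  intros Hq. pose proof (Cmod_ge_0 q).
  destruct (qpoch_bounded a q Hq) as [K [HK Hb]].
  destruct (geom_bounded_ex_series (fun n => - (a * q ^ n * qpoch a q n)) (Cmod q))
    as [l Hl]; [lra| |].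
  - exists (Cmod a * K)%R. pose proof (Cmod_ge_0 a). split; [nra|].
    intros n. rewrite Cmod_opp, !Cmod_mult, Cmod_pow.
    specialize (Hb n). pose proof (pow_le_one (Cmod q) n ltac:(lra)).
    assert (0 <= Cmod a * Cmod q ^ n)%R by nra. nra.
  - apply is_series_converges in Hl.
    assert (Hc : converges (qpoch a q) (1 + l)).
    { apply converges_S.
      eapply converges_ext; [|apply converges_plus; [apply (converges_const 1)|exact Hl]].
      intros n. cbv beta. induction n as [|n IH].
      - rewrite csum_0. simpl. ring.
      - rewrite csum_S.
        change (qpoch a q (S (S n))) with (qpoch a q (S n) * (1 - a * q ^ S n)).
        rewrite <- IH at 1. rewrite <- IH. ring. }
    unfold qpoch_inf. now rewrite (CLim_seq_unique _ _ Hc).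
Qed.

Lemma qpoch_inf_neq0 (a q : C) :
  (Cmod q < 1)%R -> (forall k, a * q ^ k <> 1) -> qpoch_inf a q <> 0.
Proof.
  intros Hq H E. destruct (qpoch_ge a q Hq H) as [d [Hd Hn]].
  pose proof (converges_Cmod _ _ (qpoch_converges a q Hq)) as HL.
  rewrite E, Cmod_0 in HL.
  assert (Rbar_le d 0).
  { eapply is_lim_seq_le; [exact Hn|apply is_lim_seq_const|exact HL]. }
  simpl in *. lra.
Qed.

Lemma qpoch_inf_S (a q : C) :
  (Cmod q < 1)%R -> qpoch_inf a q = (1 - a) * qpoch_inf (a * q) q.
Proof.
  intros Hq. apply (converges_unique (fun n => qpoch a q (S n))).
  - apply -> converges_S. now apply qpoch_converges.
  - eapply converges_ext; [intros n; symmetry; apply qpoch_S_left|].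
    now apply converges_scal, qpoch_converges.
Qed.

Lemma qpoch_inv_bounded (a q : C) :
  (Cmod q < 1)%R -> (forall k, a * q ^ k <> 1) ->
  exists K, (0 <= K)%R /\ forall n, (Cmod (/ qpoch a q n) <= K)%R.
Proof.
  intros Hq H. destruct (qpoch_ge a q Hq H) as [d [Hd Hn]].
  exists (/ d)%R. split; [left; now apply Rinv_0_lt_compat|].
  intros n. rewrite Cmod_inv by now apply qpoch_neq0.
  now apply Rinv_le_contravar.
Qed.

Lemma qpochs_neq0 (cs : list C) (q : C) (n : nat) :
  (forall c, In c cs -> forall k, c * q ^ k <> 1) -> qpochs cs q n <> 0.
Proof.
  induction cs as [|c cs IH]; intros H; simpl.
  - apply C1_nz.
  - apply Cmult_neq_0.
    + apply qpoch_neq0, H. now left.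
    + apply IH. intros c' Hc'. apply H. now right.
Qed.

Lemma qpochs_bounded (cs : list C) (q : C) :
  (Cmod q < 1)%R ->
  exists K, (0 <= K)%R /\ forall n, (Cmod (qpochs cs q n) <= K)%R.
Proof.
  intros Hq. induction cs as [|c cs [K [HK IH]]]; simpl.
  - exists 1%R. split; [lra|]. intros _. rewrite Cmod_1. lra.
  - destruct (qpoch_bounded c q Hq) as [L [HL Hc]].
    exists (L * K)%R. split; [nra|]. intros n. rewrite Cmod_mult.
    apply Rmult_le_compat; auto using Cmod_ge_0.
Qed.

Lemma qpochs_ge (cs : list C) (q : C) :
  (Cmod q < 1)%R -> (forall c, In c cs -> forall k, c * q ^ k <> 1) ->
  exists d, (0 < d)%R /\ forall n, (d <= Cmod (qpochs cs q n))%R.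
Proof.
  intros Hq. induction cs as [|c cs IH]; intros H; simpl.
  - exists 1%R. split; [lra|]. intros _. rewrite Cmod_1. lra.
  - destruct (qpoch_ge c q Hq (H c (or_introl eq_refl))) as [d [Hd Hc]].
    destruct IH as [e [He IH]]; [intros c' Hc'; apply H; now right|].
    exists (d * e)%R. split; [nra|]. intros n. rewrite Cmod_mult.
    apply Rmult_le_compat; auto; lra.
Qed.

Lemma qpochs_converges (cs : list C) (q : C) :
  (Cmod q < 1)%R -> converges (qpochs cs q) (qpochs_inf cs q).
Proof.
  intros Hq. induction cs as [|c cs IH]; simpl.
  - apply converges_const.
  - apply converges_mult; [now apply qpoch_converges|exact IH].
Qed.

(** Once a factor has vanished, the symbol stays zero: this is how a parameter
    [q ^ (- k)] makes a basic hypergeometric series terminate. *)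
Lemma qpochs_terminating (cs : list C) (q : C) (c : C) (k n : nat) :
  In c cs -> c * q ^ k = 1 -> (k < n)%nat -> qpochs cs q n = 0.
Proof.
  intros Hin Hc Hn.
  assert (H0 : qpoch c q n = 0).
  { induction Hn as [|n Hn IH]; simpl.
    - rewrite Hc. ring.
    - rewrite IH. ring. }
  induction cs as [|c' cs IH]; [easy|]. simpl.
  destruct Hin as [->|Hin].
  - rewrite H0. ring.
  - rewrite IH by easy. ring.
Qed.

(** * Sums against q-binomial coefficients *)

Definition qbinom_sum (q : C) (B : nat -> C) (n : nat) : C :=
  sum_n (fun k => qbinom q n k * B k) n.

Lemma qbinom_sum_ext (q : C) (A B : nat -> C) (n : nat) :
  (forall k, A k = B k) -> qbinom_sum q A n = qbinom_sum q B n.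
Proof. intros H. apply csum_ext. intros k _. now rewrite H. Qed.

Lemma qbinom_sum_lin (q c : C) (A B : nat -> C) (n : nat) :
  qbinom_sum q (fun k => A k + c * B k) n
  = qbinom_sum q A n + c * qbinom_sum q B n.
Proof.
  unfold qbinom_sum. rewrite <- csum_scal, <- csum_plus.
  apply csum_ext. intros k _. ring.
Qed.

Lemma qbinom_sum_scal (q c : C) (B : nat -> C) (n : nat) :
  qbinom_sum q (fun k => c * B k) n = c * qbinom_sum q B n.
Proof.
  unfold qbinom_sum. rewrite <- csum_scal. apply csum_ext. intros k _. ring.
Qed.

Lemma qq_neq0 (q : C) (n : nat) : (Cmod q < 1)%R -> qpoch q q n <> 0.
Proof. intros Hq. apply qpoch_neq0. now apply qq_neq1. Qed.

Lemma one_minus_qS_neq0 (q : C) (n : nat) : (Cmod q < 1)%R -> 1 - q * q ^ n <> 0.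
Proof. intros Hq. apply one_minus_neq0. now apply qq_neq1. Qed.

Lemma qbinom_sum_0 (q : C) (B : nat -> C) : qbinom_sum q B 0 = B 0%nat.
Proof.
  unfold qbinom_sum. rewrite csum_0. unfold qbinom. simpl. field.
Qed.

(** Absorption: [1 - q ^ k] cancels the top factor of [(q; q)_k] and lowers
    both entries of the q-binomial coefficient. *)
Lemma qbinom_sum_absorb_low (q : C) (B : nat -> C) (n : nat) :
  (Cmod q < 1)%R ->
  qbinom_sum q (fun k => (1 - q ^ k) * B k) (S n)
  = (1 - q ^ S n) * qbinom_sum q (fun k => B (S k)) n.
Proof.
  intros Hq. unfold qbinom_sum.
  rewrite csum_S_left, <- csum_scal.
  replace (qbinom q (S n) 0 * ((1 - q ^ 0) * B 0%nat)) with (RtoC 0)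
    by (simpl; ring).
  rewrite Cplus_0_l. apply csum_ext. intros k Hk. unfold qbinom.
  replace (S n - S k)%nat with (n - k)%nat by lia.
  simpl qpoch. rewrite !Cpow_S. field.
  repeat split; try apply qq_neq0; try apply one_minus_qS_neq0; assumption.
Qed.

(** Absorption on the other side: [q ^ k - q ^ (n + 1)] is [q ^ k] times
    the top factor of [(q; q)_(n + 1 - k)]. *)
Lemma qbinom_sum_absorb_high (q : C) (B : nat -> C) (n : nat) :
  (Cmod q < 1)%R ->
  qbinom_sum q (fun k => (q ^ k - q ^ S n) * B k) (S n)
  = (1 - q ^ S n) * qbinom_sum q (fun k => q ^ k * B k) n.
Proof.
  intros Hq. unfold qbinom_sum. rewrite csum_S, <- csum_scal.
  replace (qbinom q (S n) (S n) * ((q ^ S n - q ^ S n) * B (S n))) with (RtoC 0)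
    by ring.
  rewrite Cplus_0_r. apply csum_ext. intros k Hk. unfold qbinom.
  replace (S n - k)%nat with (S (n - k)) by lia.
  replace (q ^ S n) with (q * q ^ (n - k) * q ^ k).
  2:{ rewrite <- Cmult_assoc, <- Cpow_add_r.
      replace (n - k + k)%nat with n by lia. now rewrite Cpow_S. }
  simpl qpoch.
  replace (q ^ n) with (q ^ (n - k) * q ^ k)
    by (rewrite <- Cpow_add_r; f_equal; lia).
  field.
  repeat split; try apply qq_neq0; try apply one_minus_qS_neq0; assumption.
Qed.

(** The q-Pascal rule in summed form.  The factors of the two absorption
    identities add up to [1 - q ^ (n + 1)], which can be cancelled. *)
Lemma qbinom_sum_pascal (q : C) (B : nat -> C) (n : nat) :
  (Cmod q < 1)%R ->
  qbinom_sum q B (S n) = qbinom_sum q (fun k => q ^ k * B k + B (S k)) n.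
Proof.
  intros Hq.
  assert (Hn : 1 - q ^ S n <> 0)
    by (rewrite Cpow_S; now apply one_minus_qS_neq0).
  assert (E : (1 - q ^ S n) * qbinom_sum q B (S n)
    = (1 - q ^ S n) * qbinom_sum q (fun k => q ^ k * B k + B (S k)) n).
  { rewrite (qbinom_sum_ext q (fun k => q ^ k * B k + B (S k))
               (fun k => q ^ k * B k + 1 * B (S k))) by (intros; ring).
    rewrite qbinom_sum_lin.
    rewrite Cmult_plus_distr_l, Cmult_1_l.
    rewrite <- qbinom_sum_absorb_low, <- qbinom_sum_absorb_high by assumption.
    rewrite <- qbinom_sum_scal.
    rewrite (qbinom_sum_ext q (fun k => (1 - q ^ S n) * B k)
       (fun k => (q ^ k - q ^ S n) * B k + 1 * ((1 - q ^ k) * B k)))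
      by (intros; ring).
    rewrite qbinom_sum_lin. ring. }
  replace (qbinom_sum q B (S n))
    with (/ (1 - q ^ S n) * ((1 - q ^ S n) * qbinom_sum q B (S n))) by (field; easy).
  rewrite E. field. easy.
Qed.

Lemma hahn_qbinom_sum (al q mu : C) (n : nat) :
  hahn al q n mu = qbinom_sum q (fun k => qpoch al q k * mu ^ k) n.
Proof. apply csum_ext. intros k _. ring. Qed.

(** The two quantities [h_n] and [T_n], the latter weighted by [q ^ k], satisfy
    a first-order linear system by the q-Pascal rule and absorption.  Eliminating
    [(1 - al mu) T_n] gives the recurrence; only this product is replaced, so
    that [al mu = 1] is no exception. *)
Lemma hahn_recurrence (al q mu : C) (n : nat) :
  (Cmod q < 1)%R ->
  hahn al q (S (S n)) mu
  = (1 + mu - al * mu * q ^ S n) * hahn al q (S n) mu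
    - mu * (1 - q ^ S n) * hahn al q n mu.
Proof.
  intros Hq. rewrite !hahn_qbinom_sum.
  set (B := fun k => qpoch al q k * mu ^ k).
  set (T := fun n => qbinom_sum q (fun k => q ^ k * B k) n).
  assert (HB : forall k, B (S k) = mu * B k + - (al * mu) * (q ^ k * B k)).
  { intros k. unfold B. rewrite Cpow_S. simpl qpoch. ring. }
  assert (HS : forall m, qbinom_sum q (fun k => B (S k)) m
                         = mu * qbinom_sum q B m + - (al * mu) * T m).
  { intros m. rewrite (qbinom_sum_ext _ _ _ _ HB).
    now rewrite (qbinom_sum_lin q _ (fun k => mu * B k)), qbinom_sum_scal. }
  assert (H1 : forall m, qbinom_sum q B (S m)
                         = mu * qbinom_sum q B m + (1 - al * mu) * T m).
  { intros m. rewrite qbinom_sum_pascal by assumption.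
    rewrite (qbinom_sum_ext q _ (fun k => q ^ k * B k + 1 * B (S k)))
      by (intros; ring).
    rewrite qbinom_sum_lin, HS. fold (T m). ring. }
  assert (H2 : T (S n) = qbinom_sum q B (S n)
     - (1 - q ^ S n) * (mu * qbinom_sum q B n + - (al * mu) * T n)).
  { rewrite <- HS, <- qbinom_sum_absorb_low by assumption. unfold T.
    rewrite (qbinom_sum_ext q (fun k => (1 - q ^ k) * B k)
       (fun k => B k + -(1) * (q ^ k * B k))) by (intros; ring).
    rewrite qbinom_sum_lin. ring. }
  rewrite (H1 (S n)), H2.
  replace (qbinom_sum q B (S n)) with
    (al * mu * qbinom_sum q B (S n) + (1 - al * mu) * qbinom_sum q B (S n)) at 2
    by ring.
  rewrite (H1 n). ring.
Qed.

(** The terminating 3Phi1 series of the theorem with the powers of [q] cancelled.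
    In this form it is a deformation in [w] of the Hahn polynomial, which is
    recovered at [w = 0]. *)
Definition terminating_3phi1 (al q mu w : C) (j : nat) : C :=
  qbinom_sum q
    (fun k => qpoch al q k * qpoch w q k / qpoch (al * mu * w) q k * mu ^ k) j.

(** After the q-Pascal rule both sides are sums against the same q-binomial
    coefficients, and the summands agree because
    [1 - w q ^ k - w mu (1 - al q ^ k) (1 - w q ^ k) / (1 - al mu w q ^ k)]
    is [(1 - mu w) (1 - w q ^ k) / (1 - al mu w q ^ k)]. *)
Lemma terminating_3phi1_contiguous (al q mu w : C) (j : nat) :
  (Cmod q < 1)%R -> (forall k, al * mu * w * q ^ k <> 1) ->
  (1 - al * mu * w) * (terminating_3phi1 al q mu w j - w * terminating_3phi1 al q mu w (S j))
  = (1 - w) * (1 - mu * w) * terminating_3phi1 al q mu (w * q) j.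
Proof.
  intros Hq Hv. unfold terminating_3phi1. set (v := al * mu * w) in *.
  set (B := fun k => qpoch al q k * qpoch w q k / qpoch v q k * mu ^ k).
  rewrite (qbinom_sum_pascal q B j) by assumption.
  replace (qbinom_sum q B j - w * qbinom_sum q (fun k => q ^ k * B k + B (S k)) j)
    with (qbinom_sum q B j + - w * qbinom_sum q (fun k => q ^ k * B k + B (S k)) j)
    by ring.
  rewrite <- qbinom_sum_lin. rewrite <- !qbinom_sum_scal.
  apply qbinom_sum_ext. intros k. unfold B.
  assert (Hv1 : 1 - v <> 0).
  { apply one_minus_neq0. specialize (Hv 0%nat). simpl in Hv.
    now rewrite Cmult_1_r in Hv. }
  assert (Hvk : 1 - v * q ^ k <> 0) by apply one_minus_neq0, Hv.
  assert (Hpk : qpoch v q k <> 0) by now apply qpoch_neq0.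
  replace (al * mu * (w * q)) with (v * q) by (unfold v; ring).
  assert (E : qpoch (v * q) q k = qpoch v q k * (1 - v * q ^ k) / (1 - v)).
  { change (qpoch v q k * (1 - v * q ^ k)) with (qpoch v q (S k)).
    rewrite qpoch_S_left. field. exact Hv1. }
  rewrite E.
  replace ((1 - w) * (1 - mu * w)
     * (qpoch al q k * qpoch (w * q) q k
        / (qpoch v q k * (1 - v * q ^ k) / (1 - v)) * mu ^ k))
    with ((1 - mu * w)
     * (qpoch al q k * ((1 - w) * qpoch (w * q) q k)
        / (qpoch v q k * (1 - v * q ^ k) / (1 - v)) * mu ^ k))
    by (field; auto).
  rewrite <- qpoch_S_left. simpl qpoch. rewrite Cpow_S.
  unfold v in *. field. auto.
Qed.

(** * The generating function of the shifted Hahn polynomials *)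

(** For a shift [S] of sequences this is [h] acted on by the Euler series
    [1 / (w S; q)_oo].  With [h] the Hahn polynomials it is the inner sum of the
    bilinear series once that is summed first over the powers of [y]. *)
Definition shifted_sum (q w : C) (h : nat -> C) (j : nat) : C :=
  CSeries (fun m => w ^ m / qpoch q q m * h (j + m)%nat).

Lemma shifted_term_bound (q : C) (h : nat -> C) (r : R) :
  (Cmod q < 1)%R -> (0 <= r)%R -> geom_bounded h r ->
  exists K, (0 <= K)%R /\ forall w j m,
    (Cmod (w ^ m / qpoch q q m * h (j + m)%nat) <= K * r ^ j * (Cmod w * r) ^ m)%R.
Proof.
  intros Hq Hr [K [HK Hh]].
  destruct (qpoch_inv_bounded q q Hq (qq_neq1 q Hq)) as [L [HL Hi]].
  exists (L * K)%R. split; [nra|]. intros w j m. unfold Cdiv.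
  rewrite !Cmod_mult, Cmod_pow, Rpow_mult_distr.
  specialize (Hh (j + m)%nat). specialize (Hi m). rewrite pow_add in Hh.
  replace (L * K * r ^ j * (Cmod w ^ m * r ^ m))%R
    with ((Cmod w ^ m * L) * (K * (r ^ j * r ^ m)))%R by ring.
  pose proof (pow_le (Cmod w) m (Cmod_ge_0 w)).
  apply Rmult_le_compat; auto using Cmod_ge_0.
  - apply Rmult_le_pos; auto using Cmod_ge_0.
  - apply Rmult_le_compat_l; auto.
Qed.

Lemma is_series_shifted_sum (q w : C) (h : nat -> C) (r : R) (j : nat) :
  (Cmod q < 1)%R -> (0 <= r)%R -> geom_bounded h r -> (Cmod w * r < 1)%R ->
  is_series (fun m => w ^ m / qpoch q q m * h (j + m)%nat) (shifted_sum q w h j).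
Proof.
  intros Hq Hr Hh Hw.
  destruct (shifted_term_bound q h r Hq Hr Hh) as [K [HK Hb]].
  destruct (geom_bounded_ex_series
    (fun m => w ^ m / qpoch q q m * h (j + m)%nat) (Cmod w * r)) as [l Hl].
  - pose proof (Cmod_ge_0 w). nra.
  - exists (K * r ^ j)%R. split; [|intros m; apply Hb].
    apply Rmult_le_pos; [easy|]. now apply pow_le.
  - unfold shifted_sum. now rewrite (CSeries_unique _ _ Hl).
Qed.

Lemma shifted_sum_tail (q : C) (h : nat -> C) (r : R) :
  (Cmod q < 1)%R -> (0 <= r)%R -> geom_bounded h r ->
  exists K, (0 <= K)%R /\ forall w j M, (Cmod w * r < 1)%R ->
    (Cmod (shifted_sum q w h j
           - (sum_n (fun m => w ^ m / qpoch q q m * h (j + m)%nat)%C M : C))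
     <= K * r ^ j * (Cmod w * r) ^ S M / (1 - Cmod w * r))%R.
Proof.
  intros Hq Hr Hh.
  destruct (shifted_term_bound q h r Hq Hr Hh) as [K [HK Hb]].
  exists K. split; [easy|]. intros w j M Hw.
  apply series_tail_le.
  - pose proof (Cmod_ge_0 w). nra.
  - apply Rmult_le_pos; [easy|]. now apply pow_le.
  - intros m. apply Hb.
  - now apply is_series_shifted_sum with r.
Qed.

(** The bound is linear in [|w|], so replacing [w] by [w q ^ n] and letting
    [n] grow recovers [h] itself. *)
Lemma shifted_sum_near (q : C) (h : nat -> C) (r : R) :
  (Cmod q < 1)%R -> (0 <= r)%R -> geom_bounded h r ->
  exists K, (0 <= K)%R /\ forall w j, (Cmod w * r < 1)%R ->
    (Cmod (shifted_sum q w h j - h j)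
     <= K * r ^ j * (Cmod w * r) / (1 - Cmod w * r))%R.
Proof.
  intros Hq Hr Hh. destruct (shifted_sum_tail q h r Hq Hr Hh) as [K [HK Ht]].
  exists K. split; [easy|]. intros w j Hw.
  specialize (Ht w j 0%nat Hw). rewrite csum_0, pow_1 in Ht.
  replace (w ^ 0 / qpoch q q 0 * h (j + 0)%nat) with (h j) in Ht; [exact Ht|].
  rewrite Nat.add_0_r. simpl. field.
Qed.

Lemma shifted_sum_geom_bounded (q w : C) (h : nat -> C) (r : R) :
  (Cmod q < 1)%R -> (0 <= r)%R -> geom_bounded h r -> (Cmod w * r < 1)%R ->
  geom_bounded (shifted_sum q w h) r.
Proof.
  intros Hq Hr Hh Hw.
  destruct (shifted_sum_near q h r Hq Hr Hh) as [K [HK Hn]].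
  destruct Hh as [L [HL Hh]]. pose proof (Cmod_ge_0 w).
  exists (K * (Cmod w * r) / (1 - Cmod w * r) + L)%R. split.
  - apply Rplus_le_le_0_compat; [|easy].
    apply Rdiv_le_0_compat; [|lra]. apply Rmult_le_pos; nra.
  - intros j. replace (shifted_sum q w h j)
      with ((shifted_sum q w h j - h j) + h j) by ring.
    eapply Rle_trans; [apply Cmod_triangle|].
    specialize (Hn w j Hw). specialize (Hh j).
    replace ((K * (Cmod w * r) / (1 - Cmod w * r) + L) * r ^ j)%R
      with (K * r ^ j * (Cmod w * r) / (1 - Cmod w * r) + L * r ^ j)%R
      by (field; lra).
    lra.
Qed.

Lemma Cmod_mult_q_lt (w q : C) (k : nat) (r : R) :
  (Cmod q < 1)%R -> (0 <= r)%R -> (Cmod w * r < 1)%R ->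
  (Cmod (w * q ^ k) * r < 1)%R.
Proof.
  intros Hq Hr Hw. pose proof (Cmod_mult_pow_le w q k Hq). nra.
Qed.

Lemma shifted_sum_limit (q w : C) (h : nat -> C) (r : R) (j : nat) :
  (Cmod q < 1)%R -> (0 <= r)%R -> geom_bounded h r -> (Cmod w * r < 1)%R ->
  converges (fun n => shifted_sum q (w * q ^ n) h j) (h j).
Proof.
  intros Hq Hr Hh Hw.
  destruct (shifted_sum_near q h r Hq Hr Hh) as [K [HK Hn]].
  pose proof (Cmod_ge_0 w). pose proof (Cmod_ge_0 q). pose proof (pow_le r j Hr).
  apply converges_squeeze
    with (fun n => K * r ^ j * (Cmod w * r) / (1 - Cmod w * r) * Cmod q ^ n)%R.
  - intros n. pose proof (Cmod_mult_q_lt w q n r Hq Hr Hw) as Hwn.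
    eapply Rle_trans; [apply Hn; exact Hwn|].
    rewrite Cmod_mult, Cmod_pow in *.
    pose proof (pow_le_one (Cmod q) n ltac:(lra)).
    replace (K * r ^ j * (Cmod w * r) / (1 - Cmod w * r) * Cmod q ^ n)%R
      with (K * r ^ j * (Cmod w * Cmod q ^ n * r) * / (1 - Cmod w * r))%R
      by (field; lra).
    unfold Rdiv. apply Rmult_le_compat_l.
    + repeat apply Rmult_le_pos; lra.
    + apply Rinv_le_contravar; [lra|].
      assert (Cmod w * r * Cmod q ^ n <= Cmod w * r * 1)%R
        by (apply Rmult_le_compat_l; [nra|lra]). lra.
  - replace (Finite 0)
      with (Finite (K * r ^ j * (Cmod w * r) / (1 - Cmod w * r) * 0))
      by (f_equal; ring).
    apply is_lim_seq_mult'; [apply is_lim_seq_const|].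
    apply is_lim_seq_geom. rewrite Rabs_pos_eq; lra.
Qed.

(** The factor [1 - q ^ m] cancels the top factor of [(q; q)_m] and shifts the
    index of summation. *)
Lemma is_series_shifted_sum_lower (q w : C) (h : nat -> C) (r : R) (j : nat) :
  (Cmod q < 1)%R -> (0 <= r)%R -> geom_bounded h r -> (Cmod w * r < 1)%R ->
  is_series (fun m => (1 - q ^ m) * (w ^ m / qpoch q q m) * h (j + pred m)%nat)
            (w * shifted_sum q w h j).
Proof.
  intros Hq Hr Hh Hw.
  set (a := fun m => (1 - q ^ m) * (w ^ m / qpoch q q m) * h (j + pred m)%nat).
  replace (w * shifted_sum q w h j) with (a 0%nat + w * shifted_sum q w h j).
  2:{ unfold a. simpl. field. }
  apply is_series_shift.
  apply (is_series_cext
          (fun m => w * (w ^ m / qpoch q q m * h (j + m)%nat))).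
  - intros m. unfold a. simpl pred. simpl qpoch. rewrite !Cpow_S.
    assert (qpoch q q m <> 0) by now apply qq_neq0.
    assert (1 - q * q ^ m <> 0) by now apply one_minus_qS_neq0.
    simpl. field. auto.
  - apply (is_series_scal w (fun m => w ^ m / qpoch q q m * h (j + m)%nat)).
    now apply is_series_shifted_sum with r.
Qed.

(** The operator form of [(1 - w S) / (w S; q)_oo = 1 / (w q S; q)_oo].  Both
    the evaluation for Hahn polynomials and the recovery of [h] rest on it. *)
Lemma shifted_sum_q_shift (q w : C) (h : nat -> C) (r : R) (j : nat) :
  (Cmod q < 1)%R -> (0 <= r)%R -> geom_bounded h r -> (Cmod w * r < 1)%R ->
  shifted_sum q w h j - w * shifted_sum q w h (S j) = shifted_sum q (w * q) h j.
Proof.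
  intros Hq Hr Hh Hw.
  pose proof (Cmod_mult_q_lt w q 1 r Hq Hr Hw) as Hwq.
  rewrite Cpow_1_r in Hwq.
  pose proof (is_series_shifted_sum q w h r j Hq Hr Hh Hw) as H1.
  pose proof (is_series_shifted_sum_lower q w h r (S j) Hq Hr Hh Hw) as H2.
  pose proof (is_series_shifted_sum q (w * q) h r j Hq Hr Hh Hwq) as H3.
  pose proof (is_series_lin (-(1)) _ _ _ _ H1 H2) as H4. cbv beta in H4.
  replace (shifted_sum q w h j - w * shifted_sum q w h (S j))
    with (shifted_sum q w h j + - (1) * (w * shifted_sum q w h (S j))) by ring.
  refine (is_series_eq _ _ _ H4 _).
  refine (is_series_cext _ _ _ _ H3).
  intros [|m].
  - simpl. field.
  - replace (S j + pred (S m))%nat with (j + S m)%nat by (simpl; lia).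
    rewrite Cpow_mult_l. field. now apply qq_neq0.
Qed.

(** There are [n + 1] summands, each of size at most a constant times
    [max (1, |mu|) ^ n].  The factor [n + 1] is really there for
    [mu = 1] and [al = 0], hence the strict inequality. *)
Lemma hahn_geom_bounded (al q mu : C) (r : R) :
  (Cmod q < 1)%R -> (Rmax 1 (Cmod mu) < r)%R ->
  geom_bounded (fun n => hahn al q n mu) r.
Proof.
  intros Hq Hr. set (M := Rmax 1 (Cmod mu)) in *.
  assert (HM : (1 <= M)%R) by apply Rmax_l.
  assert (HM2 : (Cmod mu <= M)%R) by apply Rmax_r.
  destruct (qpoch_inv_bounded q q Hq (qq_neq1 q Hq)) as [L [HL Hi]].
  destruct (qpoch_bounded q q Hq) as [P [HP Hp]].
  destruct (qpoch_bounded al q Hq) as [A [HA Ha]].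
  destruct (linear_geom_bounded M r ltac:(lra)) as [K [HK Hlin]].
  exists (P * L * L * A * K)%R. split; [repeat apply Rmult_le_pos; assumption|].
  intros n. eapply Rle_trans; [apply Cmod_csum_le with (B := (P * L * L * A * M ^ n)%R)|].
  - intros k Hk. unfold qbinom.
    replace (qpoch q q n / (qpoch q q k * qpoch q q (n - k)))
      with (qpoch q q n * / qpoch q q k * / qpoch q q (n - k))
      by (field; split; now apply qq_neq0).
    rewrite !Cmod_mult, Cmod_pow.
    assert (Cmod mu ^ k <= M ^ n)%R.
    { eapply Rle_trans; [apply pow_incr; split; [apply Cmod_ge_0|exact HM2]|].
      now apply Rle_pow. }
    pose proof (pow_le (Cmod mu) k (Cmod_ge_0 mu)).
    repeat (apply Rmult_le_compat; auto using Cmod_ge_0;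
            try (repeat apply Rmult_le_pos; auto using Cmod_ge_0)).
  - specialize (Hlin n).
    replace (INR (S n) * (P * L * L * A * M ^ n))%R
      with ((P * L * L * A) * (INR (S n) * M ^ n))%R by ring.
    rewrite (Rmult_assoc (P * L * L * A)).
    apply Rmult_le_compat_l; [|exact Hlin]. repeat apply Rmult_le_pos; assumption.
Qed.

Lemma hahn_0 (al q mu : C) : hahn al q 0 mu = 1.
Proof. rewrite hahn_qbinom_sum, qbinom_sum_0. simpl. ring. Qed.

Lemma hahn_1 (al q mu : C) :
  (Cmod q < 1)%R -> hahn al q 1 mu = 1 + mu - al * mu.
Proof.
  intros Hq. rewrite hahn_qbinom_sum, qbinom_sum_pascal, qbinom_sum_0 by assumption.
  simpl. ring.
Qed.

(** Multiply the three-term recurrence by [w ^ n / (q; q)_n] and sum.  The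
    shifted series [shifted_sum q w h 1] that appears is removed by
    [shifted_sum_q_shift]. *)
Lemma hahn_gf_step (al q mu w : C) (r : R) :
  let G w := shifted_sum q w (fun n => hahn al q n mu) 0 in
  (Cmod q < 1)%R -> (Rmax 1 (Cmod mu) < r)%R -> (Cmod w * r < 1)%R ->
  (1 - w) * (1 - mu * w) * G w = (1 - al * mu * w) * G (w * q).
Proof.
  intros G Hq HM Hw.
  set (h := fun n => hahn al q n mu) in *.
  assert (Hr : (0 <= r)%R) by (pose proof (Rmax_l 1 (Cmod mu)); lra).
  assert (Hh : geom_bounded h r) by now apply hahn_geom_bounded.
  pose proof (Cmod_mult_q_lt w q 1 r Hq Hr Hw) as Hwq. rewrite Cpow_1_r in Hwq.
  pose proof (is_series_shifted_sum q w h r 0 Hq Hr Hh Hw) as H0.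
  pose proof (is_series_shifted_sum q (w * q) h r 0 Hq Hr Hh Hwq) as Hs.
  pose proof (is_series_shifted_sum_lower q w h r 0 Hq Hr Hh Hw) as Hl.
  pose proof (is_series_shifted_sum q w h r 1 Hq Hr Hh Hw) as H1.
  fold (G w) in H0, Hl. fold (G (w * q)) in Hs.
  pose proof (is_series_scal (1 + mu) _ _ H0) as H0'.
  pose proof (is_series_lin (- (al * mu)) _ _ _ _ H0' Hs) as H2.
  pose proof (is_series_lin (- mu) _ _ _ _ H2 Hl) as H3.
  assert (E : shifted_sum q w h 1
              = (1 + mu) * G w + - (al * mu) * G (w * q) + - mu * (w * G w)).
  { refine (is_series_eq _ _ _ H1 _).
    refine (is_series_cext _ _ _ _ H3).
    intros m. change (scal (1 + mu) ?x) with ((1 + mu) * x).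
    rewrite Cpow_mult_l. unfold h.
    assert (qpoch q q m <> 0) by now apply qq_neq0.
    destruct m as [|m].
    - simpl plus. change (1 + 0)%nat with 1%nat. change (0 + 0)%nat with 0%nat.
      rewrite hahn_1 by assumption. change (0 + pred 0)%nat with 0%nat.
      rewrite hahn_0. simpl. field.
    - change (1 + S m)%nat with (S (S m)). change (0 + S m)%nat with (S m).
      change (0 + pred (S m))%nat with m.
      rewrite hahn_recurrence by assumption. field. assumption. }
  pose proof (shifted_sum_q_shift q w h r 0 Hq Hr Hh Hw) as E2.
  fold (G w) (G (w * q)) in E2. rewrite E in E2.
  replace ((1 - w) * (1 - mu * w) * G w)
    with (G w - w * ((1 + mu) * G w + - (al * mu) * G (w * q) + - mu * (w * G w))
          - al * mu * w * G (w * q)) by ring.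
  rewrite E2. ring.
Qed.

(** Iterating [hahn_gf_step] moves the argument to [w q ^ n], where the
    generating function tends to [h_0 = 1], and leaves finite products that tend
    to the infinite ones. *)
Lemma hahn_gf (al q mu w : C) (r : R) :
  (Cmod q < 1)%R -> (Rmax 1 (Cmod mu) < r)%R -> (Cmod w * r < 1)%R ->
  qpoch_inf w q * qpoch_inf (mu * w) q
    * shifted_sum q w (fun n => hahn al q n mu) 0
  = qpoch_inf (al * mu * w) q.
Proof.
  intros Hq HM Hw. set (h := fun n => hahn al q n mu).
  assert (Hr : (0 <= r)%R) by (pose proof (Rmax_l 1 (Cmod mu)); lra).
  assert (Hh : geom_bounded h r) by now apply hahn_geom_bounded.
  apply (converges_unique
    (fun n => qpoch w q n * qpoch (mu * w) q n * shifted_sum q w h 0)).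
  - repeat apply converges_mult; auto using qpoch_converges, converges_const.
  - apply converges_ext
      with (fun n => qpoch (al * mu * w) q n * shifted_sum q (w * q ^ n) h 0).
    + induction n as [|n IH].
      * simpl. rewrite Cmult_1_r. ring.
      * simpl qpoch.
        pose proof (hahn_gf_step al q mu (w * q ^ n) r Hq HM
                      (Cmod_mult_q_lt w q n r Hq Hr Hw)) as E.
        cbv zeta beta in E. fold h in E.
        replace (w * q ^ n * q) with (w * q ^ S n) in E by (rewrite Cpow_S; ring).
        replace (qpoch w q n * (1 - w * q ^ n)
                 * (qpoch (mu * w) q n * (1 - mu * w * q ^ n)) * shifted_sum q w h 0)
          with ((1 - w * q ^ n) * (1 - mu * (w * q ^ n))
                * (qpoch w q n * qpoch (mu * w) q n * shifted_sum q w h 0)) by ring.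
        rewrite <- IH.
        replace ((1 - w * q ^ n) * (1 - mu * (w * q ^ n))
                 * (qpoch (al * mu * w) q n * shifted_sum q (w * q ^ n) h 0))
          with (qpoch (al * mu * w) q n * ((1 - w * q ^ n) * (1 - mu * (w * q ^ n))
                 * shifted_sum q (w * q ^ n) h 0)) by ring.
        rewrite E. ring.
    + replace (qpoch_inf (al * mu * w) q) with (qpoch_inf (al * mu * w) q * h 0%nat)
        by (unfold h; rewrite hahn_0; ring).
      apply converges_mult; [now apply qpoch_converges|].
      now apply shifted_sum_limit with r.
Qed.

Lemma qpoch_0 (q : C) (n : nat) : qpoch 0 q n = 1.
Proof. induction n as [|n IH]; simpl; [easy|]. rewrite IH. ring. Qed.

Lemma qpoch_inf_0 (q : C) : qpoch_inf 0 q = 1.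
Proof.
  apply CLim_seq_unique. apply converges_ext with (fun _ => RtoC 1).
  - intros n. now rewrite qpoch_0.
  - apply converges_const.
Qed.

(** Divided by the two products on the left, both sides become solutions of
    [U_j(w) - w U_(j+1)(w) = U_j(w q)]: the left one by
    [shifted_sum_q_shift], the right one by [terminating_3phi1_contiguous].  For
    nonzero [w] this determines [U_(j+1)] from [U_j], and [U_0] is the generating
    function.  At [w = 0] both sides are the Hahn polynomial itself. *)
Lemma hahn_shifted_sum (al q mu w : C) (r : R) (j : nat) :
  (Cmod q < 1)%R -> (Rmax 1 (Cmod mu) < r)%R -> (Cmod w * r < 1)%R ->
  (forall k, al * mu * w * q ^ k <> 1) ->
  qpoch_inf w q * qpoch_inf (mu * w) q
    * shifted_sum q w (fun n => hahn al q n mu) j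
  = qpoch_inf (al * mu * w) q * terminating_3phi1 al q mu w j.
Proof.
  intros Hq HM. set (h := fun n => hahn al q n mu).
  assert (Hr : (0 <= r)%R) by (pose proof (Rmax_l 1 (Cmod mu)); lra).
  assert (Hh : geom_bounded h r) by now apply hahn_geom_bounded.
  revert w. induction j as [|j IH]; intros w Hw Hv.
  - unfold h. rewrite (hahn_gf al q mu w r) by assumption.
    unfold terminating_3phi1. rewrite qbinom_sum_0. simpl. field.
  - destruct (Ceq_dec w 0) as [->|Hw0].
    + replace (mu * 0) with (RtoC 0) by ring.
      replace (al * mu * 0) with (RtoC 0) by ring.
      rewrite qpoch_inf_0, !Cmult_1_l.
      replace (terminating_3phi1 al q mu 0 (S j)) with (h (S j)).
      2:{ unfold h, terminating_3phi1. rewrite hahn_qbinom_sum. apply qbinom_sum_ext.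
          intros k. replace (al * mu * 0) with (RtoC 0) by ring.
          rewrite qpoch_0. field. }
      apply (converges_unique (fun n => shifted_sum q (0 * q ^ n) h (S j))).
      * apply converges_ext with (fun _ => shifted_sum q 0 h (S j)).
        -- intros n. now rewrite Cmult_0_l.
        -- apply converges_const.
      * now apply shifted_sum_limit with r.
    + pose proof (Cmod_mult_q_lt w q 1 r Hq Hr Hw) as Hwq. rewrite Cpow_1_r in Hwq.
      assert (Hvq : forall k, al * mu * (w * q) * q ^ k <> 1).
      { intros k. replace (al * mu * (w * q) * q ^ k)
          with (al * mu * w * q ^ S k) by (rewrite Cpow_S; ring). apply Hv. }
      pose proof (IH w Hw Hv) as E1. pose proof (IH (w * q) Hwq Hvq) as E2.
      pose proof (shifted_sum_q_shift q w h r j Hq Hr Hh Hw) as E3.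
      pose proof (terminating_3phi1_contiguous al q mu w j Hq Hv) as E4.
      rewrite <- E3 in E2. clear E3 IH.
      replace (mu * (w * q)) with (mu * w * q) in E2 by ring.
      replace (al * mu * (w * q)) with (al * mu * w * q) in E2 by ring.
      rewrite (qpoch_inf_S w q), (qpoch_inf_S (mu * w) q),
        (qpoch_inf_S (al * mu * w) q) in E1 |- * by assumption.
      set (P1 := qpoch_inf (w * q) q) in *. set (P2 := qpoch_inf (mu * w * q) q) in *.
      set (N := qpoch_inf (al * mu * w * q) q) in *.
      set (G0 := shifted_sum q w h j) in *. set (G1 := shifted_sum q w h (S j)) in *.
      set (F0 := terminating_3phi1 al q mu w j) in *. set (F1 := terminating_3phi1 al q mu w (S j)) in *.
      set (Fq := terminating_3phi1 al q mu (w * q) j) in *.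
      assert (E : w * ((1 - w) * P1 * ((1 - mu * w) * P2) * G1)
                  = w * ((1 - al * mu * w) * N * F1)).
      { replace (w * ((1 - w) * P1 * ((1 - mu * w) * P2) * G1))
          with ((1 - w) * P1 * ((1 - mu * w) * P2) * G0
                - (1 - w) * (1 - mu * w) * (P1 * P2 * (G0 - w * G1))) by ring.
        rewrite E1, E2.
        replace ((1 - w) * (1 - mu * w) * (N * Fq))
          with (N * ((1 - w) * (1 - mu * w) * Fq)) by ring.
        rewrite <- E4. ring. }
      apply (f_equal (fun z => / w * z)) in E.
      rewrite !Cmult_assoc, Cinv_l, !Cmult_1_l in E by assumption.
      rewrite !Cmult_assoc. exact E.
Qed.

(** * Rearrangement of the double series *)

Definition convolution (u v : nat -> C) (n : nat) : C :=
  sum_n (fun k => u k * v (n - k)%nat) n.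

(** Both sides sum over the triangle [k + m <= N], by antidiagonals and by rows. *)
Lemma convolution_triangle (c d h : nat -> C) (N : nat) :
  sum_n (fun n => h n * convolution c d n) N
  = sum_n (fun k => c k * (sum_n (fun m => d m * h (k + m)%nat) (N - k) : C)) N :> C.
Proof.
  induction N as [|N IH].
  - unfold convolution. rewrite !csum_0. change (0 - 0)%nat with 0%nat. change (0 + 0)%nat with 0%nat. ring.
  - rewrite csum_S, IH. rewrite (csum_S _ N).
    replace (S N - S N)%nat with 0%nat by lia. rewrite csum_0, Nat.add_0_r.
    rewrite (csum_ext
      (fun k => c k * (sum_n (fun m => d m * h (k + m)%nat) (S N - k) : C))
      (fun k => c k * (sum_n (fun m => d m * h (k + m)%nat) (N - k) : C)
                + h (S N) * (c k * d (S N - k)%nat)) N).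
    + rewrite csum_plus, csum_scal. unfold convolution. rewrite (csum_S _ N).
      replace (S N - S N)%nat with 0%nat by lia. ring.
    + intros k Hk. replace (S N - k)%nat with (S (N - k)) by lia.
      rewrite csum_S. replace (k + S (N - k))%nat with (S N) by lia. ring.
Qed.

(** The difference of the partial sums is the sum over [k <= N] of [c k] times the
    tail beyond [N - k] of the series for [shifted_sum q w h k].  The term of
    index [k] is at most a constant times [(xi r) ^ k (|w| r) ^ (N - k)], so the
    difference vanishes in the limit. *)
Lemma rearrangement (q w : C) (c h : nat -> C) (xi r : R) :
  (Cmod q < 1)%R -> (0 <= xi)%R -> (0 <= r)%R ->
  geom_bounded c xi -> geom_bounded h r -> (xi * r < 1)%R -> (Cmod w * r < 1)%R ->
  converges (fun N =>
      (sum_n (fun k => c k * shifted_sum q w h k) N : C)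
      - (sum_n (fun n => h n * convolution c (fun m => w ^ m / qpoch q q m) n) N : C))
    0.
Proof.
  intros Hq Hxi Hr [C0 [HC Hc]] Hh Hxr Hwr.
  destruct (shifted_sum_tail q h r Hq Hr Hh) as [K [HK Ht]].
  pose proof (Cmod_ge_0 w) as Hw0.
  set (e := (Cmod w * r)%R) in *. assert (He : (0 <= e < 1)%R) by (unfold e in *; nra).
  set (th := Rmax (xi * r) e).
  assert (Hth : (0 <= th < 1)%R).
  { unfold th. split; [apply Rle_trans with e; [lra|apply Rmax_r]|].
    now apply Rmax_lub_lt. }
  destruct (linear_geom_bounded th ((1 + th) / 2) ltac:(lra)) as [L [HL Hlin]].
  set (B := (C0 * K / (1 - e))%R).
  assert (HB : (0 <= B)%R).
  { unfold B. apply Rdiv_le_0_compat; [|lra]. now apply Rmult_le_pos. }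
  apply converges_squeeze with (fun N => B * L * ((1 + th) / 2) ^ N)%R.
  2:{ apply geom_null. lra. }
  intros N. rewrite convolution_triangle.
  set (P := fun k => (sum_n (fun m => w ^ m / qpoch q q m * h (k + m)%nat) (N - k) : C)).
  (* The difference of the partial sums collects the tails of the rows. *)
  match goal with |- (Cmod ?X <= _)%R =>
    replace X with (sum_n (fun k => c k * (shifted_sum q w h k - P k)) N : C)
  end.
  2:{ change (fun k => c k * (sum_n (fun m => w ^ m / qpoch q q m * h (k + m)%nat)
                                 (N - k) : C)) with (fun k => c k * P k).
      rewrite (csum_ext (fun k => c k * (shifted_sum q w h k - P k))
         (fun k => c k * shifted_sum q w h k + - (1) * (c k * P k)))
        by (intros; ring).
      rewrite csum_plus, csum_scal. ring. }
  eapply Rle_trans; [apply Cmod_csum_le with (B := (B * th ^ N)%R)|].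
  - intros k Hk. rewrite Cmod_mult.
    specialize (Hc k). specialize (Ht w k (N - k)%nat Hwr). fold (P k) e in Ht.
    assert (H1 : (e ^ S (N - k) <= th ^ (N - k))%R).
    { simpl. pose proof (pow_le e (N - k) ltac:(lra)).
      assert (e ^ (N - k) <= th ^ (N - k))%R
        by (apply pow_incr; split; [lra|apply Rmax_r]). nra. }
    assert (H2 : ((xi * r) ^ k <= th ^ k)%R).
    { apply pow_incr. split; [now apply Rmult_le_pos|apply Rmax_l]. }
    assert (H3 : (th ^ N = th ^ k * th ^ (N - k))%R).
    { rewrite <- pow_add. f_equal. lia. }
    rewrite H3.
    eapply Rle_trans; [apply Rmult_le_compat; [apply Cmod_ge_0|apply Cmod_ge_0
                        |exact Hc|exact Ht]|].
    replace (C0 * xi ^ k * (K * r ^ k * e ^ S (N - k) / (1 - e)))%R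
      with (B * ((xi * r) ^ k * e ^ S (N - k)))%R
      by (unfold B; rewrite Rpow_mult_distr; field; lra).
    apply Rmult_le_compat_l; [exact HB|].
    apply Rmult_le_compat; auto.
    + apply pow_le. now apply Rmult_le_pos.
    + apply pow_le. lra.
  - specialize (Hlin N).
    replace (INR (S N) * (B * th ^ N))%R with (B * (INR (S N) * th ^ N))%R by ring.
    rewrite Rmult_assoc. now apply Rmult_le_compat_l.
Qed.

(** * Decay of the Hahn polynomials *)

(** In terms of generating functions, [(1 - a X) g] has radius of convergence
    larger than [|z|], and the claim is that [g] has too.  If [|a z| < 1] the root
    of the factor lies outside the disc.  Otherwise the hypothesis
    [z ^ n g_n -> 0] excludes a pole there: the recurrence can be run backwards
    from infinity, and [g] inherits the rate of [k]. *)
Lemma first_order_decay (g k : nat -> C) (a z : C) (s : R) :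
  (0 < s)%R -> (s * Cmod z < 1)%R -> geom_bounded k s ->
  (forall n, g (S n) = a * g n + k n) ->
  converges (fun n => z ^ n * g n) 0 ->
  exists r, (0 < r)%R /\ (r * Cmod z < 1)%R /\ geom_bounded g r.
Proof.
  intros Hs Hsz [K [HK Hk]] Hg Hlim.
  pose proof (Cmod_ge_0 z) as Hz. pose proof (Cmod_ge_0 a) as Ha.
  destruct (Rlt_le_dec (Cmod a * Cmod z) 1) as [Haz|Haz].
  - destruct (room_below (Rmax (Cmod a) s) (Cmod z)) as [r [Hr Hrz]]; auto.
    + apply Rle_trans with s; [lra|apply Rmax_r].
    + apply Rmax_case; lra.
    + assert (Har : (Cmod a < r)%R) by (eapply Rle_lt_trans; [apply Rmax_l|exact Hr]).
      assert (Hsr : (s < r)%R) by (eapply Rle_lt_trans; [apply Rmax_r|exact Hr]).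
      exists r. split; [lra|]. split; [exact Hrz|].
      set (K' := Rmax (Cmod (g 0%nat)) (K / (r - Cmod a))).
      assert (HK' : (K <= K' * (r - Cmod a))%R).
      { replace K with (K / (r - Cmod a) * (r - Cmod a))%R at 1 by (field; lra).
        apply Rmult_le_compat_r; [lra|apply Rmax_r]. }
      exists K'. split.
      { eapply Rle_trans; [apply Cmod_ge_0|apply Rmax_l]. }
      induction n as [|n IH].
      * simpl. rewrite Rmult_1_r. apply Rmax_l.
      * rewrite Hg. eapply Rle_trans; [apply Cmod_triangle|]. rewrite Cmod_mult.
        specialize (Hk n).
        assert (K * s ^ n <= K * r ^ n)%R
          by (apply Rmult_le_compat_l; [easy|apply pow_incr; lra]).
        assert (Cmod a * Cmod (g n) <= Cmod a * (K' * r ^ n))%R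
          by (now apply Rmult_le_compat_l).
        assert (K * r ^ n <= K' * (r - Cmod a) * r ^ n)%R
          by (apply Rmult_le_compat_r; [apply pow_le; lra|easy]).
        simpl pow. lra.
  - exists s. split; [easy|]. split; [easy|].
    assert (Hz0 : (0 < Cmod z)%R) by nra.
    (* [D s ^ n] is the fixed point of the reversed recurrence
       [v_n <= |z| v_(n+1) + K |z| s ^ n]. *)
    set (D := (K * Cmod z / (1 - s * Cmod z))%R).
    assert (HD : (0 <= D)%R).
    { apply Rdiv_le_0_compat; [|lra]. now apply Rmult_le_pos. }
    exists D. split; [exact HD|]. intros n.
    assert (Hstep : forall n, (Cmod (g n) - D * s ^ n
               <= Cmod z * (Cmod (g (S n)) - D * s ^ S n))%R).
    { intros m. specialize (Hk m).
      assert (Ha1 : (Cmod a * Cmod (g m) <= Cmod (g (S m)) + K * s ^ m)%R).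
      { rewrite <- Cmod_mult.
        replace (a * g m) with (g (S m) + - k m) by (rewrite Hg; ring).
        eapply Rle_trans; [apply Cmod_triangle|]. rewrite Cmod_opp. lra. }
      assert (HDe : (D * s ^ m - Cmod z * (D * s ^ S m) = K * Cmod z * s ^ m)%R)
        by (unfold D; simpl; field; lra).
      pose proof (Cmod_ge_0 (g m)).
      assert (Cmod (g m) <= Cmod z * (Cmod a * Cmod (g m)))%R by nra.
      assert (Cmod z * (Cmod a * Cmod (g m))
              <= Cmod z * (Cmod (g (S m)) + K * s ^ m))%R
        by (now apply Rmult_le_compat_l).
      lra. }
    assert (Hp : forall p, (Cmod (g n) - D * s ^ n
               <= Cmod z ^ p * (Cmod (g (p + n)%nat) - D * s ^ (p + n)))%R).
    { induction p as [|p IH].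
      - simpl. lra.
      - eapply Rle_trans; [exact IH|]. change (S p + n)%nat with (S (p + n)).
        replace (Cmod z ^ S p)%R with (Cmod z ^ p * Cmod z)%R by (simpl; ring).
        rewrite Rmult_assoc. apply Rmult_le_compat_l; [now apply pow_le|apply Hstep]. }
    apply converges_Cmod in Hlim. rewrite Cmod_0 in Hlim.
    apply (is_lim_seq_incr_n _ n) in Hlim.
    assert (H : Rbar_le (Cmod z ^ n * (Cmod (g n) - D * s ^ n))%R 0).
    { eapply is_lim_seq_le; [|apply is_lim_seq_const|exact Hlim].
      intros p. cbv beta. rewrite Cmod_mult, Cmod_pow, pow_add.
      specialize (Hp p). pose proof (pow_le (Cmod z) n Hz) as Hzn.
      pose proof (pow_le (Cmod z) p Hz).
      assert (0 <= D * s ^ (p + n))%R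
        by (apply Rmult_le_pos; [easy|apply pow_le; lra]).
      assert (Cmod z ^ p * (Cmod (g (p + n)%nat) - D * s ^ (p + n))
              <= Cmod z ^ p * Cmod (g (p + n)%nat))%R
        by (apply Rmult_le_compat_l; lra).
      replace (Cmod z ^ p * Cmod z ^ n * Cmod (g (p + n)%nat))%R
        with (Cmod z ^ n * (Cmod z ^ p * Cmod (g (p + n)%nat)))%R by ring.
      apply Rmult_le_compat_l; lra. }
    simpl in H. pose proof (pow_lt (Cmod z) n Hz0). nra.
Qed.

(** The recurrence reads [(E - 1) (E - mu) h = O(q ^ n h)] for the shift [E].  As
    [h = O(|z| ^ (- n))], the right side is smaller by the factor [q ^ n], and
    [first_order_decay] removes the two first-order factors in turn.  Thus [h] is
    either not null at the scale [z ^ n] or exponentially smaller. *)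
Lemma hahn_decay (al q mu z : C) :
  q <> 0 -> z <> 0 -> (Cmod q < 1)%R ->
  converges (fun n => z ^ n * hahn al q n mu) 0 ->
  exists r, (0 < r)%R /\ (r * Cmod z < 1)%R /\ geom_bounded (fun n => hahn al q n mu) r.
Proof.
  intros Hq0 Hz0 Hq Hlim. set (h := fun n => hahn al q n mu) in *.
  assert (Hz : (0 < Cmod z)%R) by now apply Cmod_gt_0.
  assert (Hqp : (0 < Cmod q)%R) by now apply Cmod_gt_0.
  assert (Hhz : geom_bounded h (/ Cmod z)).
  { apply geom_bounded_unscale; [easy|]. now apply converges_bounded with (RtoC 0). }
  set (s := (Cmod q * / Cmod z)%R).
  assert (Hs : (0 < s)%R).
  { apply Rmult_lt_0_compat; [easy|]. now apply Rinv_0_lt_compat. }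
  assert (Hsz : (s * Cmod z < 1)%R).
  { unfold s. rewrite Rmult_assoc, Rinv_l by lra. lra. }
  assert (Hqh : geom_bounded (fun n => q ^ n * h n) s)
    by (apply geom_bounded_mult; [apply geom_bounded_pow|exact Hhz]).
  (* [g = (E - 1) h] satisfies [(E - mu) g = O(s ^ n)]. *)
  set (g := fun n => h (S n) + - (1) * h n).
  assert (Hg : converges (fun n => z ^ n * g n) 0).
  { replace (RtoC 0) with (/ z * 0 + - (1) * 0) by ring.
    apply converges_ext
      with (fun n => / z * (z ^ S n * h (S n)) + - (1) * (z ^ n * h n)).
    - intros n. unfold g. rewrite Cpow_S. field. easy.
    - apply converges_plus; apply converges_scal; [|exact Hlim].
      now apply (converges_S (fun n => z ^ n * h n)). }
  destruct (first_order_decay g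
    (fun n => - (al * mu) * (q ^ S n * h (S n)) + mu * q * (q ^ n * h n)) mu z s)
    as [r1 [Hr1 [Hr1z Hgr]]]; auto.
  { apply geom_bounded_lin; [|exact Hqh].
    apply (geom_bounded_S (fun n => q ^ n * h n)); [lra|exact Hqh]. }
  { intros n. unfold g, h. rewrite hahn_recurrence by assumption.
    rewrite Cpow_S. ring. }
  destruct (first_order_decay h g 1 z r1) as [r [Hr [Hrz Hh]]]; auto.
  { intros n. unfold g. ring. }
  now exists r.
Qed.

(** * From the terms of either series to the Hahn polynomials *)

(** Passing from [w q ^ i] to [w q ^ (i + 1)] by [shifted_sum_q_shift] multiplies
    a bound on all terms of index at least [J] by [1 + |w / z| |q| ^ i].  The
    product of these factors is finite, and [h] is the limit for large [i]. *)
Lemma null_of_shifted_sum_null (q w z : C) (h : nat -> C) (r : R) :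
  (Cmod q < 1)%R -> (0 <= r)%R -> geom_bounded h r -> (Cmod w * r < 1)%R ->
  z <> 0 ->
  converges (fun j => z ^ j * shifted_sum q w h j) 0 ->
  converges (fun j => z ^ j * h j) 0.
Proof.
  intros Hq Hr Hh Hw Hz0 Hlim.
  assert (Hz : (0 < Cmod z)%R) by now apply Cmod_gt_0.
  pose proof (Cmod_ge_0 q) as Hq0. pose proof (Cmod_ge_0 w) as Hw0.
  set (x := (Cmod w / Cmod z)%R).
  assert (Hx : (0 <= x)%R) by (apply Rdiv_le_0_compat; lra).
  set (E := exp_geom x (Cmod q)).
  set (P := exp (x / (1 - Cmod q))).
  assert (HEP : forall i, (E i <= P)%R) by (intros i; apply exp_geom_le; lra).
  assert (Hi : forall (e : R) (J : nat), (0 <= e)%R ->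
     (forall j, (J <= j)%nat -> (Cmod (z ^ j * shifted_sum q w h j) <= e)%R) ->
     forall i j, (J <= j)%nat ->
     (Cmod (z ^ j * shifted_sum q (w * q ^ i) h j) <= e * E i)%R).
  { intros e J He HJ. induction i as [|i IH]; intros j Hj.
    - unfold E. rewrite exp_geom_0 by easy. simpl Cpow.
      rewrite Cmult_1_r, Rmult_1_r. now apply HJ.
    - pose proof (shifted_sum_q_shift q (w * q ^ i) h r j Hq Hr Hh
                    (Cmod_mult_q_lt w q i r Hq Hr Hw)) as Es.
      replace (w * q ^ i * q) with (w * q ^ S i) in Es by (rewrite Cpow_S; ring).
      rewrite <- Es.
      set (G0 := shifted_sum q (w * q ^ i) h j) in *.
      replace (z ^ j * (G0 - w * q ^ i * shifted_sum q (w * q ^ i) h (S j)))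
        with (z ^ j * G0 + - (w / z * q ^ i
                * (z ^ S j * shifted_sum q (w * q ^ i) h (S j))))
        by (rewrite Cpow_S; field; easy).
      eapply Rle_trans; [apply Cmod_triangle|].
      rewrite Cmod_opp, (Cmod_mult (w / z * q ^ i)), (Cmod_mult (w / z)),
        Cmod_div, Cmod_pow by easy. fold x.
      pose proof (IH j Hj) as I0. pose proof (IH (S j) ltac:(lia)) as I1.
      fold G0 in I0.
      assert (HE : (E i * (1 + x * Cmod q ^ i) <= E (S i))%R)
        by now apply exp_geom_S.
      assert (0 <= x * Cmod q ^ i)%R
        by (apply Rmult_le_pos; [easy|apply pow_le; lra]).
      assert (x * Cmod q ^ i * Cmod (z ^ S j * shifted_sum q (w * q ^ i) h (S j))
              <= x * Cmod q ^ i * (e * E i))%R by (now apply Rmult_le_compat_l).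
      assert (e * (E i * (1 + x * Cmod q ^ i)) <= e * E (S i))%R
        by (now apply Rmult_le_compat_l).
      lra. }
  apply is_lim_seq_spec. intros eps.
  assert (HP : (0 < P)%R) by apply exp_pos.
  assert (He : (0 < eps / (2 * P))%R)
    by (apply Rdiv_lt_0_compat; [apply cond_pos|lra]).
  apply is_lim_seq_spec in Hlim.
  destruct (Hlim (mkposreal _ He)) as [J HJ]. exists J. intros j Hj.
  rewrite Rminus_0_r, Rabs_pos_eq by apply Cmod_ge_0.
  replace (z ^ j * h j - 0) with (z ^ j * h j) by ring.
  assert (HL : converges (fun i => z ^ j * shifted_sum q (w * q ^ i) h j) (z ^ j * h j))
    by (apply converges_scal; now apply shifted_sum_limit with r).
  apply converges_Cmod in HL.
  assert (H : Rbar_le (Cmod (z ^ j * h j)) (eps / (2 * P) * P)%R).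
  { eapply is_lim_seq_le; [|exact HL|apply is_lim_seq_const].
    intros i. cbv beta. eapply Rle_trans.
    - apply (Hi (eps / (2 * P))%R J); [lra| |exact Hj].
      intros j' Hj'. specialize (HJ j' Hj'). simpl in HJ.
      rewrite Rminus_0_r, Rabs_pos_eq in HJ by apply Cmod_ge_0.
      replace (z ^ j' * shifted_sum q w h j' - 0)
        with (z ^ j' * shifted_sum q w h j') in HJ by ring. lra.
    - apply Rmult_le_compat_l; [lra|apply HEP]. }
  simpl in H. replace (eps / (2 * P) * P)%R with (eps / 2)%R in H by (field; lra).
  pose proof (cond_pos eps). lra.
Qed.

(** Beyond the index where [e] is small, [s] exceeds a small constant only by a
    geometrically decaying amount. *)
Lemma contraction_null (s e : nat -> R) (th : R) :
  (0 <= th < 1)%R -> (forall n, 0 <= s n)%R ->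
  (forall n, s (S n) <= th * s n + e n)%R ->
  is_lim_seq e 0 -> is_lim_seq s 0.
Proof.
  intros Hth Hs Hstep He. apply is_lim_seq_spec. intros eps.
  pose proof (cond_pos eps) as Hp.
  apply is_lim_seq_spec in He.
  assert (H1 : (0 < eps / 2 * (1 - th))%R) by (apply Rmult_lt_0_compat; lra).
  destruct (He (mkposreal _ H1)) as [N HN].
  assert (Hn : forall p, (s (p + N)%nat <= eps / 2 + s N * th ^ p)%R).
  { induction p as [|p IH].
    - simpl. lra.
    - change (S p + N)%nat with (S (p + N)).
      specialize (Hstep (p + N)%nat). specialize (HN (p + N)%nat ltac:(lia)).
      simpl in HN. rewrite Rminus_0_r in HN. apply Rabs_def2 in HN.
      assert (th * s (p + N)%nat <= th * (eps / 2 + s N * th ^ p))%R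
        by (apply Rmult_le_compat_l; lra).
      simpl pow. lra. }
  pose proof (geom_null (s N) th Hth) as HG. apply is_lim_seq_spec in HG.
  assert (H2 : (0 < eps / 2)%R) by lra.
  destruct (HG (mkposreal _ H2)) as [M HM].
  exists (M + N)%nat. intros n Hn'.
  specialize (HM (n - N)%nat ltac:(lia)). simpl in HM.
  rewrite Rminus_0_r in HM. apply Rabs_def2 in HM.
  specialize (Hn (n - N)%nat). replace (n - N + N)%nat with n in Hn by lia.
  rewrite Rminus_0_r, Rabs_pos_eq by apply Hs. lra.
Qed.

(** Writing [u = l + (u - l)] leaves [l] times a partial sum of [v] and the
    convolution of a null sequence with a geometric one. *)
Lemma convolution_limit (u v : nat -> C) (l m : C) (th : R) :
  (0 <= th < 1)%R -> converges u l -> geom_bounded v th -> is_series v m ->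
  converges (convolution u v) (l * m).
Proof.
  intros Hth Hu [K [HK Hv]] Hm. apply is_series_converges in Hm.
  set (e := fun k => Cmod (u k - l)).
  set (s := fun n => sum_n (fun k => e k * th ^ (n - k))%R n).
  assert (Hs : forall n, (s (S n) = th * s n + e (S n))%R).
  { intros n. unfold s. rewrite sum_Sn. change plus with Rplus.
    rewrite Nat.sub_diag, pow_O, Rmult_1_r. f_equal.
    rewrite <- (rsum_scal th (fun k => e k * th ^ (n - k))%R n).
    apply sum_n_ext_loc. intros k Hk.
    replace (S n - k)%nat with (S (n - k)) by lia. simpl. ring. }
  assert (Hs0 : forall n, (0 <= s n)%R).
  { induction n as [|n IH].
    - unfold s. rewrite sum_O. simpl. rewrite Rmult_1_r. apply Cmod_ge_0.
    - rewrite Hs. apply Rplus_le_le_0_compat; [apply Rmult_le_pos; lra|apply Cmod_ge_0]. }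
  assert (Hnull : converges (convolution (fun k => u k - l) v) 0).
  { apply converges_squeeze with (fun n => K * s n)%R.
    - intros n. replace (convolution (fun k => u k - l) v n - 0)
        with (convolution (fun k => u k - l) v n) by ring.
      unfold convolution, s.
      rewrite <- (rsum_scal K (fun k => e k * th ^ (n - k))%R n).
      apply Cmod_csum_le_sum. intros k Hk. rewrite Cmod_mult. fold (e k).
      specialize (Hv (n - k)%nat).
      pose proof (Cmod_ge_0 (u k - l)). fold (e k) in H.
      assert (e k * Cmod (v (n - k)%nat) <= e k * (K * th ^ (n - k)))%R
        by (now apply Rmult_le_compat_l). lra.
    - replace (Finite 0) with (Finite (K * 0)) by (f_equal; ring).
      apply is_lim_seq_mult'; [apply is_lim_seq_const|].
      apply contraction_null with (fun n => e (S n)) th; auto.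
      + intros n. rewrite Hs. lra.
      + apply (is_lim_seq_incr_1 e). exact Hu. }
  replace (l * m) with (0 + l * m) by ring.
  apply converges_ext
    with (fun n => convolution (fun k => u k - l) v n + l * (sum_n v n : C)).
  - intros n. rewrite <- (csum_rev v n), <- csum_scal. unfold convolution.
    rewrite <- csum_plus. apply csum_ext. intros k _. ring.
  - apply converges_plus; [exact Hnull|]. now apply converges_scal.
Qed.

(** A zero at [w] would propagate to all [w q ^ n] by [shifted_sum_q_shift],
    where the Euler series tends to [1]. *)
Lemma euler_sum_neq0 (q w : C) :
  (Cmod q < 1)%R -> (Cmod w < 1)%R -> shifted_sum q w (fun _ => 1) 0 <> 0.
Proof.
  intros Hq Hw E0. set (h := fun _ : nat => RtoC 1) in *.
  assert (Hh : geom_bounded h 1).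
  { exists 1%R. split; [lra|]. intros n. unfold h. rewrite Cmod_1, pow1. lra. }
  assert (Hw1 : (Cmod w * 1 < 1)%R) by lra.
  assert (Hn : forall n, shifted_sum q (w * q ^ n) h 0 = 0).
  { induction n as [|n IH].
    - simpl. now rewrite Cmult_1_r.
    - replace (w * q ^ S n) with (w * q ^ n * q) by (rewrite Cpow_S; ring).
      rewrite <- (shifted_sum_q_shift q (w * q ^ n) h 1); auto; try lra.
      + change (shifted_sum q (w * q ^ n) h 1) with (shifted_sum q (w * q ^ n) h 0).
        rewrite IH. ring.
      + apply Cmod_mult_q_lt; lra. }
  pose proof (shifted_sum_limit q w h 1 0 Hq ltac:(lra) Hh Hw1) as HL.
  apply (converges_ext _ (fun _ => RtoC 0)) in HL; [|exact Hn].
  apply C1_nz. exact (converges_unique _ _ _ HL (converges_const 0)).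
Qed.

(** Since [|w| < |z|], the convolution is asymptotic to a nonzero multiple of
    [z ^ n]: the constant is [l] times the Euler series at [w / z]. *)
Lemma null_of_product_null (q w z : C) (A h : nat -> C) (l : C) :
  (Cmod q < 1)%R -> (Cmod w < Cmod z)%R -> l <> 0 -> converges A l ->
  converges (fun n => h n * convolution (fun k => A k * z ^ k)
                              (fun m => w ^ m / qpoch q q m) n) 0 ->
  converges (fun n => z ^ n * h n) 0.
Proof.
  intros Hq Hwz Hl HA Hlim.
  assert (Hz : (0 < Cmod z)%R) by (pose proof (Cmod_ge_0 w); lra).
  assert (Hz0 : z <> 0) by now apply Cmod_gt_0.
  set (p := w / z).
  assert (Hp : (Cmod p < 1)%R).
  { unfold p. rewrite Cmod_div by easy.
    apply Rmult_lt_reg_r with (Cmod z); [easy|]. field_simplify; lra. }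
  set (v := fun m => p ^ m / qpoch q q m).
  set (D := shifted_sum q p (fun _ => 1) 0).
  assert (H1 : geom_bounded (fun _ : nat => RtoC 1) 1).
  { exists 1%R. split; [lra|]. intros n. rewrite Cmod_1, pow1. lra. }
  assert (HvD : is_series v D).
  { apply (is_series_cext (fun m => p ^ m / qpoch q q m * 1)).
    - intros m. unfold v. ring.
    - apply (is_series_shifted_sum q p (fun _ => 1) 1 0); auto; lra. }
  assert (Hv : geom_bounded v (Cmod p)).
  { destruct (qpoch_inv_bounded q q Hq (qq_neq1 q Hq)) as [L [HL Hi]].
    exists L. split; [easy|]. intros m. unfold v, Cdiv.
    rewrite Cmod_mult, Cmod_pow, Rmult_comm.
    apply Rmult_le_compat_r; [apply pow_le, Cmod_ge_0|apply Hi]. }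
  assert (HE : converges (convolution A v) (l * D)).
  { apply convolution_limit with (Cmod p); auto.
    split; [apply Cmod_ge_0|easy]. }
  assert (HD : l * D <> 0)
    by (apply Cmult_neq_0; [easy|now apply euler_sum_neq0]).
  set (E := convolution A v) in *.
  assert (Hfact : forall n, convolution (fun k => A k * z ^ k)
                              (fun m => w ^ m / qpoch q q m) n = z ^ n * E n).
  { intros n. unfold E, convolution. rewrite <- csum_scal. apply csum_ext.
    intros k Hk. unfold v, p.
    replace (z ^ n) with (z ^ k * z ^ (n - k))
      by (rewrite <- Cpow_add_r; f_equal; lia).
    unfold Cdiv. rewrite Cpow_mult_l, Cpow_inv by easy.
    field. auto using Cpow_nz, qq_neq0. }
  apply (converges_cancel E _ (l * D) HD HE).
  eapply converges_ext; [|exact Hlim]. intros n. cbv beta. rewrite Hfact. ring.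
Qed.

(** These are the rates that [rearrangement] asks for.  If [A] is eventually zero,
    the rate [xi] can be chosen as small as needed.  If
    [max (1, |mu|) |z| < 1], the trivial growth of [h] suffices.  Otherwise
    [|w| < |z|], and null terms force [z ^ n h_n] to be null, hence
    exponentially small by [hahn_decay].  The limit of [A] must be nonzero for
    the terms to control [z ^ n h_n]. *)
Lemma compatible_rates (al q mu w z : C) (A : nat -> C) :
  let h := fun n => hahn al q n mu in
  q <> 0 -> (Cmod q < 1)%R -> (Rmax 1 (Cmod mu) * Cmod w < 1)%R ->
  geom_bounded A 1 ->
  ((exists N, forall n, (N < n)%nat -> A n = 0) \/ (exists l : C, l <> 0 /\ converges A l)) ->
  ((Rmax 1 (Cmod mu) * Cmod z < 1)%R
   \/ converges (fun k => A k * z ^ k * shifted_sum q w h k) 0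
   \/ converges (fun n => h n * convolution (fun k => A k * z ^ k)
                              (fun m => w ^ m / qpoch q q m) n) 0) ->
  exists xi r, (0 <= xi)%R /\ (0 <= r)%R /\ (xi * r < 1)%R /\ (Cmod w * r < 1)%R
    /\ geom_bounded (fun k => A k * z ^ k) xi /\ geom_bounded h r.
Proof.
  intros h Hq0 Hq Hw HA Hdich Hnull.
  set (M := Rmax 1 (Cmod mu)) in *.
  assert (HM : (1 <= M)%R) by apply Rmax_l.
  pose proof (Cmod_ge_0 w) as Hw0. pose proof (Cmod_ge_0 z) as Hz0.
  assert (Hcz : geom_bounded (fun k => A k * z ^ k) (Cmod z)).
  { replace (Cmod z) with (1 * Cmod z)%R by ring.
    apply geom_bounded_mult; [exact HA|apply geom_bounded_pow]. }
  destruct (room_below M (Cmod w)) as [r0 [Hr0 Hr0w]]; [lra|lra|exact Hw|].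
  destruct Hdich as [[N HN]|[l [Hl HAl]]].
  (* Any rate bounds an eventually zero sequence; this one gives [xi r0 = 1/2]. *)
  { exists (/ (2 * r0))%R, r0.
    assert (Hi : (0 < / (2 * r0))%R) by (apply Rinv_0_lt_compat; lra).
    repeat split; try lra.
    - replace (/ (2 * r0) * r0)%R with (/ 2)%R by (field; lra). lra.
    - apply geom_bounded_eventually_zero with N; [easy|].
      intros n Hn. rewrite HN by easy. ring.
    - now apply hahn_geom_bounded. }
  destruct (Rlt_le_dec (M * Cmod z) 1) as [HMz|HMz].
  { destruct (room_below M (Rmax (Cmod w) (Cmod z))) as [r [Hr Hrm]].
    - lra.
    - eapply Rle_trans; [exact Hw0|apply Rmax_l].
    - apply (Rmax_case (Cmod w) (Cmod z) (fun s => (M * s < 1)%R)); lra.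
    - pose proof (Rmax_l (Cmod w) (Cmod z)). pose proof (Rmax_r (Cmod w) (Cmod z)).
      exists (Cmod z), r.
      repeat split; try lra; try nra.
      + exact Hcz.
      + now apply hahn_geom_bounded. }
  assert (Hwz : (Cmod w < Cmod z)%R) by nra.
  assert (Hz : z <> 0) by (apply Cmod_gt_0; lra).
  assert (Hh0 : geom_bounded h r0) by now apply hahn_geom_bounded.
  assert (Hlim : converges (fun n => z ^ n * h n) 0).
  { destruct Hnull as [Hlt|[HR|HL]].
    - lra.
    - apply null_of_shifted_sum_null with q w r0; auto; try lra.
      apply (converges_cancel A _ l Hl HAl).
      eapply converges_ext; [|exact HR]. intros n. cbv beta. ring.
    - now apply null_of_product_null with q w A l. }
  destruct (hahn_decay al q mu z Hq0 Hz Hq Hlim) as [r [Hr [Hrz Hh]]].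
  exists (Cmod z), r. repeat split; try lra; try nra; assumption.
Qed.

(** * The two series of the theorem *)

Lemma qpochs_terminating_or_not (a : list C) (q : C) :
  (exists c k, In c a /\ c * q ^ k = 1) \/ (forall c, In c a -> forall k, c * q ^ k <> 1).
Proof.
  destruct (Classical_Prop.classic (exists c k, In c a /\ c * q ^ k = 1)) as [H|H].
  - now left.
  - right. intros c Hc k E. apply H. now exists c, k.
Qed.

(** A zero factor in the numerator makes the ratio terminate; without one, the
    infinite product in the numerator is nonzero. *)
Lemma qpoch_ratio_dichotomy (a b : list C) (q : C) :
  (Cmod q < 1)%R -> (forall c, In c b -> forall k, c * q ^ k <> 1) ->
  (exists N, forall n, (N < n)%nat -> qpochs a q n / qpochs b q n = 0)
  \/ (exists l : C, l <> 0 /\ converges (fun n => qpochs a q n / qpochs b q n) l).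
Proof.
  intros Hq Hb.
  assert (Hne : forall cs, (forall c, In c cs -> forall k, c * q ^ k <> 1) ->
            qpochs_inf cs q <> 0).
  { induction cs as [|c cs IH]; intros H; simpl.
    - apply C1_nz.
    - apply Cmult_neq_0.
      + apply qpoch_inf_neq0; [easy|]. apply H. now left.
      + apply IH. intros c' Hc'. apply H. now right. }
  destruct (qpochs_terminating_or_not a q) as [[c [k [Hc Hk]]]|Ha].
  - left. exists k. intros n Hn. rewrite (qpochs_terminating a q c k n) by assumption.
    unfold Cdiv. ring.
  - right. exists (qpochs_inf a q * / qpochs_inf b q). split.
    + apply Cmult_neq_0; [now apply Hne|]. apply Cinv_neq_0. now apply Hne.
    + unfold Cdiv. apply converges_mult; [now apply qpochs_converges|].
      apply converges_inv; [intros n; now apply qpochs_neq0|now apply Hne|].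
      now apply qpochs_converges.
Qed.

Lemma qpoch_ratio_bounded (a b : list C) (q : C) :
  (Cmod q < 1)%R -> (forall c, In c b -> forall k, c * q ^ k <> 1) ->
  geom_bounded (fun n => qpochs a q n / qpochs b q n) 1.
Proof.
  intros Hq Hb.
  destruct (qpochs_bounded a q Hq) as [K [HK Ha]].
  destruct (qpochs_ge b q Hq Hb) as [d [Hd Hbd]].
  exists (K * / d)%R. split.
  - apply Rmult_le_pos; [easy|]. left. now apply Rinv_0_lt_compat.
  - intros n. rewrite pow1, Rmult_1_r, Cmod_div by now apply qpochs_neq0.
    unfold Rdiv. apply Rmult_le_compat; auto using Cmod_ge_0.
    + left. apply Rinv_0_lt_compat. specialize (Hbd n). lra.
    + now apply Rinv_le_contravar.
Qed.

Lemma triangular_S (k : nat) :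
  (S k * (S k - 1) / 2 = k * (k - 1) / 2 + k)%nat.
Proof.
  destruct k as [|k]; [reflexivity|].
  replace (S (S k) * (S (S k) - 1))%nat with (S k * (S k - 1) + S k * 2)%nat by nia.
  now rewrite Nat.div_add by lia.
Qed.

(** Each factor [1 - q ^ (k - j)] is [- q ^ (k - j)] times a factor of [(q; q)_j].
    The powers of [q] are moved to the left so that no negative exponent occurs. *)
Lemma qpoch_inv_pow (q : C) (j k : nat) :
  q <> 0 -> (k <= j)%nat ->
  qpoch (/ q ^ j) q k * (q ^ j) ^ k * qpoch q q (j - k)
  = (- (1)) ^ k * q ^ (k * (k - 1) / 2) * qpoch q q j.
Proof.
  intros Hq. induction k as [|k IH]; intros Hk.
  - change (0 * (0 - 1) / 2)%nat with 0%nat. rewrite Nat.sub_0_r. simpl. ring.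
  - rewrite triangular_S, Cpow_add_r, !Cpow_S.
    replace (- (1) * (- (1)) ^ k * (q ^ (k * (k - 1) / 2) * q ^ k) * qpoch q q j)
      with (- q ^ k * ((- (1)) ^ k * q ^ (k * (k - 1) / 2) * qpoch q q j)) by ring.
    rewrite <- IH by lia.
    replace (j - k)%nat with (S (j - S k)) by lia.
    simpl qpoch.
    replace (q ^ j) with (q * q ^ (j - S k) * q ^ k).
    2:{ rewrite <- Cpow_S, <- Cpow_add_r. f_equal. lia. }
    field. repeat split; auto using Cpow_nz.
Qed.

(** The exponent [1 + v - u] is [-1] here, so the sign and the power of [q] divide;
    they cancel against those of the symbol of [q ^ (- j)]. *)
Lemma qhyper_terminating_3phi1 (al q mu w : C) (j : nat) :
  q <> 0 -> (Cmod q < 1)%R -> (forall k, al * mu * w * q ^ k <> 1) ->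
  qhyper (/ q ^ j :: al :: w :: nil) (al * mu * w :: nil) q (mu * q ^ j)
  = terminating_3phi1 al q mu w j.
Proof.
  intros Hq0 Hq Hv. unfold qhyper, terminating_3phi1, qbinom_sum.
  assert (Hj : q ^ j <> 0) by now apply Cpow_nz.
  apply CSeries_unique.
  set (u := qhyper_term _ _ _ _).
  rewrite <- (csum_ext u) .
  - apply is_series_finite. intros k Hk. unfold u, qhyper_term.
    rewrite (qpochs_terminating (/ q ^ j :: al :: w :: nil) q (/ q ^ j) j k);
      [unfold Cdiv; ring|now left|now apply Cinv_l|exact Hk].
  - intros k Hk. unfold u, qhyper_term.
    cbv [length]. change (1 + Z.of_nat 1 - Z.of_nat 3)%Z with (-1)%Z.
    unfold Cpowz. change (Pos.to_nat 1) with 1%nat. rewrite Cpow_1_r.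
    pose proof (qpoch_inv_pow q j k Hq0 Hk) as E.
    assert (Hs : (- (1)) ^ k * q ^ (k * (k - 1) / 2) <> 0).
    { apply Cmult_neq_0; apply Cpow_nz; [|easy].
      intros X. apply C1_nz. replace (RtoC 1) with (- - (1)) by ring. rewrite X. ring. }
    assert (qpoch q q k <> 0) by now apply qq_neq0.
    assert (qpoch q q (j - k) <> 0) by now apply qq_neq0.
    assert (qpoch (al * mu * w) q k <> 0) by now apply qpoch_neq0.
    unfold qbinom.
    set (sg := (- (1)) ^ k * q ^ (k * (k - 1) / 2)) in *.
    replace (qpoch q q j) with
      (/ sg * (qpoch (/ q ^ j) q k * (q ^ j) ^ k * qpoch q q (j - k)))
      by (rewrite E; field; easy).
    simpl qpochs. rewrite Cpow_mult_l. field. auto.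
Qed.

(** The factor [(q; q)_n] of the q-binomial coefficients cancels, and what is left
    is a Cauchy product. *)
Lemma bilinear_lhs_term_convolution (a b : list C) (q x y al mu t : C) (n : nat) :
  (Cmod q < 1)%R -> (forall c, In c b -> forall k, c * q ^ k <> 1) ->
  bilinear_lhs_term a b q x y al mu t n
  = hahn al q n mu
    * convolution (fun k => qpochs a q k / qpochs (q :: b) q k * (x * t) ^ k)
        (fun m => (y * t) ^ m / qpoch q q m) n.
Proof.
  intros Hq Hb. unfold bilinear_lhs_term, gen_al_salam_carlitz, convolution.
  assert (Hn : qpoch q q n <> 0) by now apply qq_neq0.
  match goal with |- ?S * ?H * ?T = _ => replace (S * H * T) with (H * (T * S)) by ring end.
  rewrite <- csum_scal. f_equal. apply csum_ext. intros k Hk.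
  assert (qpoch q q k <> 0) by now apply qq_neq0.
  assert (qpoch q q (n - k) <> 0) by now apply qq_neq0.
  assert (qpochs b q k <> 0) by now apply qpochs_neq0.
  replace (t ^ n) with (t ^ k * t ^ (n - k)) by (rewrite <- Cpow_add_r; f_equal; lia).
  rewrite !Cpow_mult_l. unfold qbinom. simpl qpochs. field. auto.
Qed.

Lemma Rmax_mult_lt (w mu : C) (c : R) :
  (Rmax (Cmod w) (Cmod (mu * w)) < c)%R -> (Rmax 1 (Cmod mu) * Cmod w < c)%R.
Proof.
  intros H. rewrite Cmod_mult in H.
  pose proof (Rmax_l (Cmod w) (Cmod mu * Cmod w)).
  pose proof (Rmax_r (Cmod w) (Cmod mu * Cmod w)).
  apply Rmax_case; lra.
Qed.

Theorem theorem9 (r : nat) (a b : list C) (q x y alpha mu t : C)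
    (len_a : length a = S r) (len_b : length b = r)
    (q_neq0 : q <> 0) (q_lt1 : (Cmod q < 1)%R)
    (b_ok : forall c, In c b -> forall k : nat, c * q ^ k <> 1)
    (den_ok : forall k : nat, alpha * mu * y * t * q ^ k <> 1)
    (hmax : (Rmax (Cmod (y * t)) (Cmod (mu * y * t)) < 1)%R) :
  ((Rmax (Cmod (x * t)) (Cmod (mu * x * t)) < 1)%R ->
     ex_series (bilinear_lhs_term a b q x y alpha mu t))
  /\
  (forall s : C,
     is_series (bilinear_lhs_term a b q x y alpha mu t)
               (bilinear_rhs_factor q y alpha mu t * s)
     <-> is_series (bilinear_rhs_term a b q x y alpha mu t) s).
Proof.
  clear r len_a len_b.
  set (w := y * t) in *. set (z := x * t) in *.
  replace (mu * y * t) with (mu * w) in hmax by (unfold w; ring).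
  replace (mu * x * t) with (mu * z) by (unfold z; ring).
  assert (den_ok' : forall k, alpha * mu * w * q ^ k <> 1).
  { intros k. replace (alpha * mu * w) with (alpha * mu * y * t) by (unfold w; ring).
    apply den_ok. }
  pose proof (Rmax_mult_lt w mu 1 hmax) as Hw.
  set (h := fun n => hahn alpha q n mu).
  set (A := fun k => qpochs a q k / qpochs (q :: b) q k).
  set (F := bilinear_rhs_factor q y alpha mu t).
  set (LHS := bilinear_lhs_term a b q x y alpha mu t).
  set (RHS := bilinear_rhs_term a b q x y alpha mu t).
  assert (Hqb : forall c, In c (q :: b) -> forall k, c * q ^ k <> 1).
  { intros c [<-|Hc]; [now apply qq_neq1|now apply b_ok]. }
  assert (HL : forall n, LHS n = h n * convolution (fun k => A k * z ^ k)
                               (fun m => w ^ m / qpoch q q m) n)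
    by (intros n; now apply bilinear_lhs_term_convolution).
  pose proof (Cmod_ge_0 w) as Hw0.
  assert (Hw1 : (Cmod w < 1)%R) by (eapply Rle_lt_trans; [apply Rmax_l|exact hmax]).
  assert (Hmw1 : (Cmod (mu * w) < 1)%R)
    by (eapply Rle_lt_trans; [apply Rmax_r|exact hmax]).
  assert (HN : qpoch_inf (alpha * mu * w) q <> 0) by now apply qpoch_inf_neq0.
  assert (HP1 : qpoch_inf w q <> 0)
    by (apply qpoch_inf_neq0; [easy|intros k; now apply mult_pow_neq1]).
  assert (HP2 : qpoch_inf (mu * w) q <> 0)
    by (apply qpoch_inf_neq0; [easy|intros k; now apply mult_pow_neq1]).
  assert (HF : F = qpoch_inf (alpha * mu * w) q
                   / (qpoch_inf w q * qpoch_inf (mu * w) q)).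
  { unfold F, bilinear_rhs_factor. simpl qpochs_inf. fold w.
    replace (alpha * mu * y * t) with (alpha * mu * w) by (unfold w; ring).
    replace (mu * y * t) with (mu * w) by (unfold w; ring). field. auto. }
  assert (HF0 : F <> 0).
  { rewrite HF. apply Cmult_neq_0; [easy|]. apply Cinv_neq_0.
    now apply Cmult_neq_0. }
  assert (HR : forall k, A k * z ^ k * shifted_sum q w h k = F * RHS k).
  { destruct (room_below (Rmax 1 (Cmod mu)) (Cmod w)) as [r0 [Hr0 Hr0w]]; auto.
    { eapply Rle_trans; [|apply Rmax_l]. lra. }
    intros k. unfold RHS, bilinear_rhs_term. fold w z.
    replace (alpha * mu * y * t) with (alpha * mu * w) by (unfold w; ring).
    rewrite qhyper_terminating_3phi1 by assumption. fold (A k).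
    pose proof (hahn_shifted_sum alpha q mu w r0 k q_lt1 Hr0
                  ltac:(lra) den_ok') as E. fold h in E.
    rewrite HF.
    replace (shifted_sum q w h k) with
      (/ (qpoch_inf w q * qpoch_inf (mu * w) q)
       * (qpoch_inf w q * qpoch_inf (mu * w) q * shifted_sum q w h k))
      by (field; auto).
    rewrite E. field. auto. }
  assert (Hrates : (Rmax 1 (Cmod mu) * Cmod z < 1)%R
            \/ converges (fun k => A k * z ^ k * shifted_sum q w h k) 0
            \/ converges LHS 0 ->
    exists xi r, (0 <= xi)%R /\ (0 <= r)%R /\ (xi * r < 1)%R /\ (Cmod w * r < 1)%R
      /\ geom_bounded (fun k => A k * z ^ k) xi /\ geom_bounded h r).
  { intros H. apply (compatible_rates alpha q mu w z A); auto.
    - now apply qpoch_ratio_bounded.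
    - now apply qpoch_ratio_dichotomy.
    - destruct H as [H|[H|H]]; auto. right. right.
      now apply (converges_ext LHS). }
  assert (Hiff : (Rmax 1 (Cmod mu) * Cmod z < 1)%R
            \/ converges (fun k => A k * z ^ k * shifted_sum q w h k) 0
            \/ converges LHS 0 ->
    forall s, is_series LHS (F * s) <-> is_series RHS s).
  { intros H s. destruct (Hrates H) as [xi [r [Hxi [Hr [Hxr [Hwr [Hc Hh]]]]]]].
    pose proof (rearrangement q w _ h xi r q_lt1 Hxi Hr Hc Hh Hxr Hwr) as HD.
    rewrite !is_series_converges.
    assert (HD' : converges (fun N => F * (sum_n RHS N : C) - (sum_n LHS N : C)) 0).
    { eapply converges_ext; [|exact HD]. intros N. cbv beta.
      rewrite <- csum_scal.
      apply (f_equal2 Cminus); apply csum_ext; intros k _;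
        [apply HR|symmetry; apply HL]. }
    rewrite <- (converges_of_difference_null _ _ _ HD').
    split; intros HS.
    - replace s with (/ F * (F * s)) by (field; easy).
      apply converges_ext with (fun N => / F * (F * (sum_n RHS N : C))).
      + intros N. field. easy.
      + now apply converges_scal.
    - now apply converges_scal. }
  split.
  - intros Hz. apply Rmax_mult_lt in Hz.
    destruct (Hrates (or_introl Hz)) as [xi [r [Hxi [Hr [Hxr [Hwr [Hc Hh]]]]]]].
    destruct (geom_bounded_ex_series
      (fun k => A k * z ^ k * shifted_sum q w h k) (xi * r)) as [l Hl].
    + split; [now apply Rmult_le_pos|easy].
    + apply geom_bounded_mult; [exact Hc|now apply shifted_sum_geom_bounded].
    + exists (F * (/ F * l)). apply Hiff; [now left|].
      apply (is_series_cext (fun k => / F * (A k * z ^ k * shifted_sum q w h k))).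
      * intros k. rewrite HR. field. easy.
      * now apply (is_series_scal (V := C_NormedModule) (/ F)).
  - intros s. split; intros H.
    + apply Hiff; [|exact H]. right. right. now apply is_series_terms_null with (F * s).
    + apply Hiff; [|exact H]. right. left.
      apply is_series_terms_null in H.
      apply converges_ext with (fun k => F * RHS k); [intros k; now rewrite HR|].
      replace (RtoC 0) with (F * 0) by ring. now apply converges_scal.
Qed.
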